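(* Let $W_3=\mathrm{Tot}(\mathcal O_{\mathbb P^1}(-3)\oplus\mathcal O_{\mathbb P^1}(1))$ and let $e_1,e_2,e_3,e_4,e_5,e_7,e_8,e_{10},e_{11},e_{13}$ be the Poisson structures on $W_3$ specified in the context. The corresponding symplectic foliations have $0$-dimensional leaves, consisting of single points, over each of their degeneracy loci, which are: $$\begin{aligned} D(e_1)&=\{u_1=0\}\cup\{\xi=0\}\cup\{v_1=0\},\\ D(e_2)&=\{u_1=0\}\cup\{u_2=0\}\cup\{v_1=0\}\cup\{v_2=0\},\\ D(e_3)&=\{\xi=0\},\\ D(e_4)&=\{z=0\}\cup\{\xi=0\},\\ D(e_5)&=\{z=0\}\cup\{\xi=v_1=0\},\\ D(e_{10})&=\{u_2=0\}\cup\{\xi=0\}\cup\{v_2=0\},\\ D(e_{11})&=\{z=0\}\cup\{u_2=0\}\cup\{v_2=0\}\cup\{\xi=v_1=0\},\\ D(e_7)&=\{u_1=0\}\cup\{\xi=0\}\cup\{v_1=0\},\\ D(e_8)&=\{z=0\}\cup\{u_1=0\}\cup\{\xi=v_2=0\}\cup\{v_1=0\},\\ D(e_{13})&=\{u_1=0\}\cup\{u_2=0\}\cup\{v_1=0\}\cup\{v_2=0\}. \end{aligned}$$ Their generic leaves, which are $2$-dimensional, are as follows: (i) isomorphic to $\mathbb C^*\times\mathbb C$ for $e_1$; (ii) isomorphic to $\mathbb C^*\times\mathbb C^*$ for $e_2$; (iii) surfaces of constant $u_1$ for $e_3,e_4,e_5,e_{10}$ and $e_{11}$; (iv) surfaces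 of constant $u_2$ for $e_7$, $e_8$ and $e_{13}$.
   Context: $W_3$ is obtained by gluing $U=\mathbb C^3_{\{z,u_1,u_2\}}$ and $V=\mathbb C^3_{\{\xi,v_1,v_2\}}$ by $(\xi,v_1,v_2)=(z^{-1},z^3u_1,z^{-1}u_2)$ where $z,\xi\neq0$. Conditions involving $z,u_1,u_2$ (resp. $\xi,v_1,v_2$) define subsets of $U$ (resp. $V$). Write $\partial_0=\partial/\partial z$, $\partial_1=\partial/\partial u_1$, $\partial_2=\partial/\partial u_2$. The global holomorphic Poisson structures on $W_3$ under consideration are given on $U$ by $$e_1=u_1\,\partial_1\wedge\partial_2,\quad e_2=u_1u_2\,\partial_1\wedge\partial_2,\quad e_3=\partial_2\wedge\partial_0,\quad e_4=z\,\partial_2\wedge\partial_0,\quad e_5=z^2\,\partial_2\wedge\partial_0,$$ $$e_7=u_1\,\partial_0\wedge\partial_1,\quad e_8=zu_1\,\partial_0\wedge\partial_1,\quad e_{10}=u_2\,\partial_2\wedge\partial_0,\quad e_{11}=zu_2\,\partial_2\wedge\partial_0,\quad e_{13}=u_1u_2\,\partial_0\wedge\partial_1 .$$ The degeneracy locus $D(\sigma)$ of a Poisson structure $\sigma$ on a threefold is the set of points where it has rank $0$. The symplectic foliation of a Poisson structure is the decomposition into its symplectic leaves (maximal connected immersed symplectic submanifolds); on a threefold the leaves are the single points of the degeneracy locus and $2$-dimensional leaves elsewhere. ''Generic leaves'' are the leaves through the points of a suitable dense open subset. A surface of constant $u_i$ is a surface on which (in the $U$ chart) the function $u_i$ is constant.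 *)

(* Defs.v *)
From HB Require Import structures.
From mathcomp Require Import all_boot all_order all_algebra.
From mathcomp Require Import generic_quotient complex.
From mathcomp Require Import all_classical all_reals all_analysis.
From mathcomp Require Import ring.

Set Implicit Arguments.
Unset Strict Implicit.
Unset Printing Implicit Defensive.

Import Order.TTheory GRing.Theory Num.Theory.
Import numFieldNormedType.Exports.

Local Open Scope classical_set_scope.
Local Open Scope ring_scope.

(* Over the numFieldType [Cplx R], [differentiable] is complex (Frechet)
   differentiability; on an open set this is holomorphy. *)
Definition Cplx (R : realType) : numClosedFieldType := R[i].

Section W3.
Variable R : realType.
Local Notation C := (Cplx R).

Definition vec3 (a b c : C) : 'rV[C]_3 := \row_j [:: a; b; c]`_j.

(* The change of coordinates z <-> xi: the same formula goes from U to V and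
   from V to U.  It is only meaningful where the first coordinate is nonzero. *)
Definition transition (x : 'rV[C]_3) : 'rV[C]_3 :=
  vec3 (x 0 0)^-1 (x 0 0 ^+ 3 * x 0 1) ((x 0 0)^-1 * x 0 2).

(* A point of the disjoint union of U (tag [true]) and V (tag [false]). *)
Definition glue : rel (bool * 'rV[C]_3) := fun p q =>
  (p == q) || [&& p.1 != q.1, p.2 0 0 != 0 & q.2 == transition p.2].

Lemma vec3E a b c : (vec3 a b c 0 0 = a) * (vec3 a b c 0 1 = b) * (vec3 a b c 0 2 = c).
Proof. by rewrite !mxE. Qed.

Lemma row3P (x y : 'rV[C]_3) :
  x 0 0 = y 0 0 -> x 0 1 = y 0 1 -> x 0 2 = y 0 2 -> x = y.
Proof.
move=> e0 e1 e2; apply/rowP => -[[|[|[|//]]] h].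
- by have -> : Ordinal h = 0 by apply: val_inj.
- by have -> : Ordinal h = 1 by apply: val_inj.
- by have -> : Ordinal h = 2 by apply: val_inj.
Qed.

Lemma transition_neq0 (x : 'rV[C]_3) : x 0 0 != 0 -> transition x 0 0 != 0.
Proof. by rewrite /transition vec3E invr_eq0. Qed.

Lemma transitionK (x : 'rV[C]_3) : x 0 0 != 0 -> transition (transition x) = x.
Proof.
move=> x0; apply: row3P; rewrite /transition !vec3E; first exact: invrK.
- by field.
- by field.
Qed.

Lemma glue_equiv : equiv_class_of glue.
Proof.
split=> [p|p q|q p r]; rewrite /glue.
- by rewrite eqxx.
- have sym a b : glue a b -> glue b a.
    case/orP=> [/eqP->|/and3P[ab a0 /eqP b2]]; first by rewrite /glue eqxx.
    apply/orP; right; apply/and3P; split; first by rewrite eq_sym.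
      by rewrite b2 transition_neq0.
    by rewrite b2 transitionK.
  by apply/idP/idP; apply: sym.
- case/orP=> [/eqP-> //|/and3P[pq p0 /eqP q2]].
  case/orP=> [/eqP<-|]; first by rewrite pq p0 q2 eqxx orbT.
  case/and3P=> qr q0 /eqP r2; apply/orP; left.
  rewrite (surjective_pairing p) (surjective_pairing r) r2 q2 transitionK //.
  by rewrite xpair_eqE eqxx andbT; case: p.1 q.1 r.1 pq qr => -[] [].
Qed.

Canonical glue_equiv_rel := EquivRelPack glue_equiv.

Definition W3 : topologicalType :=
  quotient_topology {eq_quot glue_equiv_rel}%qT.

(* [chart true] is the inclusion of U, [chart false] that of V. *)
Definition chart (c : bool) (x : 'rV[C]_3) : W3 :=
  \pi_(W3)%qT (c, x).

Definition onU (P : C -> C -> C -> Prop) : set W3 :=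
  [set chart true x | x in [set x : 'rV[C]_3 | P (x 0 0) (x 0 1) (x 0 2)]].

Definition onV (P : C -> C -> C -> Prop) : set W3 :=
  [set chart false x | x in [set x : 'rV[C]_3 | P (x 0 0) (x 0 1) (x 0 2)]].

(* A bivector \sum_(i < j) s i j d_i /\ d_j is encoded by the skew-symmetric
   matrix s; a map f pushes it forward to J^T s J, where J = 'J f x acts on row
   vectors. *)
Definition wedge (i j : 'I_3) : 'M[C]_3 := delta_mx i j - delta_mx j i.

Definition partial (l : 'I_3) (f : 'rV[C]_3 -> C) (x : 'rV[C]_3) : C :=
  'D_(delta_mx 0 l) f x.

Definition jacobi (s : 'rV[C]_3 -> 'M[C]_3) (x : 'rV[C]_3) : Prop :=
  forall i j k,
    \sum_l (s x i l * partial l (fun y => s y j k) x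
          + s x j l * partial l (fun y => s y k i) x
          + s x k l * partial l (fun y => s y i j) x) = 0.

Definition is_poisson (s : bool -> 'rV[C]_3 -> 'M[C]_3) : Prop :=
  [/\ forall c i j x, differentiable (fun y => s c y i j) x,
      forall c x, (s c x)^T = - s c x,
      forall c (x : 'rV[C]_3), x 0 0 != 0 ->
        s (~~ c) (transition x) =
          ('J transition x)^T *m s c x *m 'J transition x &
      forall c x, jacobi (s c) x].

Record poisson := Poisson {
  coef :> bool -> 'rV[C]_3 -> 'M[C]_3;
  coefP : is_poisson coef }.


Definition has_partials (x : 'rV[C]_3) (f : 'rV[C]_3 -> C) (df : 'I_3 -> C) :=
  differentiable f x /\ forall l, partial l f x = df l.

Lemma diff_coord (j : 'I_3) (x v : 'rV[C]_3) :
  'd (fun y : 'rV[C]_3 => y 0 j) x v = v 0 j.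
Proof.
have @f : {linear 'rV[C]_3 -> C}.
  by exists (fun y : 'rV[C]_3 => y 0 j); do 2![eexists]; do ?[constructor];
     rewrite ?mxE// => ? *; rewrite ?mxE//; move=> ?; rewrite !mxE.
by rewrite (_ : (fun _ => _) = f) // diff_lin //; exact/coord_continuous.
Qed.

Lemma hp_coord x j : has_partials x (fun x => x 0 j) (fun l => (l == j)%:R).
Proof.
have d : differentiable (fun y : 'rV[C]_3 => y 0 j) x.
  exact: differentiable_coord.
by split=> // l; rewrite /partial deriveE // diff_coord mxE eqxx eq_sym.
Qed.

Lemma hp_cst x a : has_partials x (fun=> a) (fun=> 0).
Proof.
split; first exact: differentiable_cst.
by move=> l; rewrite /partial derive_cst.
Qed.

Lemma hp_mul x f g df dg : has_partials x f df -> has_partials x g dg ->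
  has_partials x (fun x => f x * g x) (fun l => df l * g x + f x * dg l).
Proof.
move=> [f1 f2] [g1 g2]; split; first exact: (differentiableM f1 g1).
move=> l; rewrite /partial (_ : (fun _ => _) = f * g) // deriveM;
  try exact: diff_derivable.
by rewrite -/(partial l g x) -/(partial l f x) f2 g2 /GRing.scale /=; ring.
Qed.

Lemma hp_exp x f df n : has_partials x f df ->
  has_partials x (fun x => f x ^+ n) (fun l => n%:R * f x ^+ n.-1 * df l).
Proof.
move=> hf; elim: n => [|n IH].
  split; first exact: differentiable_cst.
  by move=> l; rewrite /partial !mul0r derive_cst.
have [d p] := hp_mul hf IH.
have e : (fun x => f x ^+ n.+1) = (fun x => f x * f x ^+ n).
  by apply/funext => y; rewrite exprS.
split; rewrite e // => l.
by rewrite p /=; case: n {IH d p e} => [|n] /=; rewrite -?natr1 ?exprS; ring.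
Qed.

Lemma hp_opp x f df : has_partials x f df ->
  has_partials x (fun x => - f x) (fun l => - df l).
Proof.
move=> [f1 f2]; split; first exact: (differentiableN f1).
move=> l; rewrite /partial (_ : (fun _ => _) = - f) // deriveN;
  last exact: diff_derivable.
by rewrite -/(partial l f x) f2.
Qed.

Lemma hp_inv x f df : f x != 0 -> has_partials x f df ->
  has_partials x (fun x => (f x)^-1) (fun l => - (f x) ^- 2 * df l).
Proof.
move=> f0 [f1 f2]; split; first exact: differentiableV.
move=> l; rewrite /partial deriveV //; last exact: diff_derivable.
by rewrite -/(partial l f x) f2.
Qed.

Lemma jacobian_hp x (f : 'rV[C]_3 -> 'rV[C]_3) (d : 'I_3 -> 'I_3 -> C) :
  (forall j, has_partials x (fun y => f y 0 j) (d j)) ->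
  forall l j, 'J f x l j = d j l.
Proof.
move=> h l j.
have df : differentiable f x.
  have -> : f = \sum_j (fun y => f y 0 j *: delta_mx 0 j).
    by apply/funext => y; rewrite fct_sumE [LHS]row_sum_delta.
  by apply: differentiable_sum => i; apply: differentiableZl; case: (h i).
have [dj <-] := h j; rewrite /partial deriveE // mxE.
rewrite (_ : (fun y => f y 0 j) = (fun y : 'rV[C]_3 => y 0 j) \o f) //.
rewrite [in RHS]diff_comp; [|exact: df|exact: differentiable_coord].
by rewrite [RHS]diff_coord.
Qed.

Lemma ord3P (P : 'I_3 -> Prop) : P 0 -> P 1 -> P 2 -> forall i, P i.
Proof.
move=> p0 p1 p2 [[|[|[|//]]] h].
- by rewrite (_ : Ordinal h = 0) //; apply: val_inj.
- by rewrite (_ : Ordinal h = 1) //; apply: val_inj.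
- by rewrite (_ : Ordinal h = 2) //; apply: val_inj.
Qed.

Lemma jacobian_transition (x : 'rV[C]_3) : x 0 0 != 0 ->
  (('J transition x 0 0 = - (x 0 0) ^- 2) *
   ('J transition x 0 1 = 3 * x 0 0 ^+ 2 * x 0 1) *
   ('J transition x 0 2 = - (x 0 0) ^- 2 * x 0 2) *
   ('J transition x 1 0 = 0) * ('J transition x 1 1 = x 0 0 ^+ 3) *
   ('J transition x 1 2 = 0) * ('J transition x 2 0 = 0) *
   ('J transition x 2 1 = 0) * ('J transition x 2 2 = (x 0 0)^-1)).
Proof.
move=> x0.
pose d (j l : 'I_3) : C := [:: - (x 0 0) ^- 2 * (l == 0)%:R;
  (3 * x 0 0 ^+ 2 * (l == 0)%:R) * x 0 1 + x 0 0 ^+ 3 * (l == 1)%:R;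
  (- (x 0 0) ^- 2 * (l == 0)%:R) * x 0 2 + (x 0 0)^-1 * (l == 2)%:R]`_j.
have E : forall l j, 'J transition x l j = d j l.
  apply: jacobian_hp; apply: ord3P.
  - rewrite (_ : (fun _ => _) = (fun y : 'rV[C]_3 => (y 0 0)^-1)).
      by apply: hp_inv => //; apply: hp_coord.
    by apply/funext => y; rewrite vec3E.
  - rewrite (_ : (fun _ => _) = (fun y : 'rV[C]_3 => y 0 0 ^+ 3 * y 0 1)).
      apply: (@hp_mul x (fun y => y 0 0 ^+ 3)); last exact: hp_coord.
      exact: (@hp_exp x (fun y => y 0 0) _ 3 (hp_coord x 0)).
    by apply/funext => y; rewrite vec3E.
  - rewrite (_ : (fun _ => _) = (fun y : 'rV[C]_3 => (y 0 0)^-1 * y 0 2)).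
      apply: (@hp_mul x (fun y => (y 0 0)^-1)); last exact: hp_coord.
      by apply: hp_inv => //; apply: hp_coord.
    by apply/funext => y; rewrite vec3E.
by rewrite /= !E /d /= !(mulr0, mulr1, mul0r, addr0, add0r).
Qed.

Lemma bivE (a b d : C) (s : 'M[C]_3) :
  s = a *: wedge 1 2 + b *: wedge 2 0 + d *: wedge 0 1 ->
  ((s 0 0 = 0) * (s 1 1 = 0) * (s 2 2 = 0) *
   (s 1 2 = a) * (s 2 1 = - a) * (s 2 0 = b) * (s 0 2 = - b) *
   (s 0 1 = d) * (s 1 0 = - d)).
Proof.
move=> ->; do !split; rewrite !mxE /=;
  by rewrite !(mulr0, mulr1, mulr0n, mulr1n, subrr, subr0, sub0r, mulrN, addr0, add0r).
Qed.

Lemma sum3 (F : 'I_3 -> C) : \sum_i F i = F 0 + F 1 + F 2.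
Proof.
rewrite !big_ord_recl big_ord0 addr0 addrA; congr (F _ + F _ + F _);
  exact: val_inj.
Qed.

Lemma is_poisson_biv (s : bool -> 'rV[C]_3 -> 'M[C]_3)
    (a b d : bool -> 'rV[C]_3 -> C) (da db dd : bool -> 'rV[C]_3 -> 'I_3 -> C) :
  (forall c x, s c x =
     a c x *: wedge 1 2 + b c x *: wedge 2 0 + d c x *: wedge 0 1) ->
  (forall c x, [/\ has_partials x (a c) (da c x), has_partials x (b c) (db c x) &
     has_partials x (d c) (dd c x)]) ->
  (forall c x, a c x * (dd c x 1 - db c x 2) + b c x * (da c x 2 - dd c x 0)
     + d c x * (db c x 0 - da c x 1) = 0) ->
  (forall c (x : 'rV[C]_3), x 0 0 != 0 -> let y := transition x in
     [/\ a (~~ c) y = x 0 0 ^+ 2 * a c x - 3 * x 0 0 * x 0 1 * b c x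
                      + x 0 0 * x 0 2 * d c x,
         b (~~ c) y = - x 0 0 ^- 3 * b c x & d (~~ c) y = - x 0 0 * d c x]) ->
  is_poisson s.
Proof.
move=> sE hp jac gl.
have E c x := bivE (sE c x).
pose ds c x (i j : 'I_3) l : C := nth 0 (nth [::]
  [:: [:: 0; dd c x l; - db c x l]; [:: - dd c x l; 0; da c x l];
      [:: db c x l; - da c x l; 0]] i) j.
have hs c i j x : has_partials x (fun y => s c y i j) (ds c x i j).
  have [ha hb hd] := hp c x.
  have hext f g h : f =1 g -> has_partials x g h -> has_partials x f h.
    by move=> /funext ->.
  by elim/ord3P: i; elim/ord3P: j => /=;
    (apply: hext; first by [move=> y; rewrite E; reflexivity]);
    try exact: hp_cst; try exact: (hp_opp ha); try exact: (hp_opp hb);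
    try exact: (hp_opp hd).
split.
- by move=> c i j x; have [] := hs c i j x.
- move=> c x; apply/matrixP; apply: ord3P; apply: ord3P;
    by rewrite !mxE !E ?oppr0 ?opprK.
- move=> c x x0; have [ga gb gd] := gl c x x0.
  move: (jacobian_transition x0); move: ('J _ _) => M JE.
  apply/matrixP; apply: ord3P; apply: ord3P;
    rewrite !E ?ga ?gb ?gd !mxE !sum3 !mxE !sum3 !mxE !JE !E; by field.
- move=> c x i j k.
  have P i' j' l : partial l (fun y => s c y i' j') x = ds c x i' j' l.
    by have [_ ->] := hs c i' j' x.
  have J := jac c x.
  rewrite sum3 !P.
  elim/ord3P: i; elim/ord3P: j; elim/ord3P: k; rewrite !E /ds /=;
   by [ring | rewrite -[RHS]J; ring | rewrite -[RHS]oppr0 -[in RHS]J; ring].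
Qed.

Definition coords T (F : C -> C -> C -> T) (x : 'rV[C]_3) : T :=
  F (x 0 0) (x 0 1) (x 0 2).

(* The bivector field given by F on U and by G on V. *)
Definition on_charts (F G : C -> C -> C -> 'M[C]_3) :
    bool -> 'rV[C]_3 -> 'M[C]_3 :=
  fun c => coords (if c then F else G).

Lemma is_poisson_charts (F G : C -> C -> C -> 'M[C]_3)
    (a b d : bool -> 'rV[C]_3 -> C) :
  (forall x, coords F x =
     a true x *: wedge 1 2 + b true x *: wedge 2 0 + d true x *: wedge 0 1) ->
  (forall x, coords G x =
     a false x *: wedge 1 2 + b false x *: wedge 2 0 + d false x *: wedge 0 1) ->
  (forall c x, exists da db dd, [/\ has_partials x (a c) da,
     has_partials x (b c) db, has_partials x (d c) dd &
     a c x * (dd 1 - db 2) + b c x * (da 2 - dd 0) + d c x * (db 0 - da 1) = 0]) ->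
  (forall c (x : 'rV[C]_3), x 0 0 != 0 -> let y := transition x in
     [/\ a (~~ c) y = x 0 0 ^+ 2 * a c x - 3 * x 0 0 * x 0 1 * b c x
                      + x 0 0 * x 0 2 * d c x,
         b (~~ c) y = - x 0 0 ^- 3 * b c x & d (~~ c) y = - x 0 0 * d c x]) ->
  is_poisson (on_charts F G).
Proof.
move=> hF hG hp gl.
apply: (@is_poisson_biv _ a b d (fun c x l => partial l (a c) x)
  (fun c x l => partial l (b c) x) (fun c x l => partial l (d c) x)) => //.
- by case.
- by move=> c x; have [da [db [dd [[ha _] [hb _] [hd _] _]]]] := hp c x.
- move=> c x; have [da [db [dd [[_ ha] [_ hb] [_ hd] <-]]]] := hp c x.
  by rewrite !ha !hb !hd.
Qed.

Ltac partials :=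
  first [ exact: hp_coord | exact: hp_cst
        | apply: hp_mul; partials | apply: hp_opp; partials
        | apply: hp_exp; partials ].

Ltac poisson_charts a b d :=
  apply: (@is_poisson_charts _ _ a b d);
  [ by move=> x; rewrite /coords /= ?scale0r ?scale1r ?scaleNr ?addr0 ?add0r
  | by move=> x; rewrite /coords /= ?scale0r ?scale1r ?scaleNr ?addr0 ?add0r
  | case=> x; (do 3! eexists; split;
      [partials | partials | partials | rewrite /=; ring])
  | by case=> x x0; rewrite /= /transition ?vec3E; split; field ].

(* The expressions on V are computed from those on U with
     d_z = - xi^2 d_xi + 3 xi v1 d_v1 - xi v2 d_v2,
     d_u1 = xi^-3 d_v1,  d_u2 = xi d_v2. *)

Lemma e1_poisson : is_poisson (on_charts
  (fun z u1 u2 => u1 *: wedge 1 2)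
  (fun xi v1 v2 => (xi * v1) *: wedge 1 2)).
Proof.
poisson_charts
  (fun (c : bool) (x : 'rV[C]_3) => (if c then x 0 1 else x 0 0 * x 0 1) : C)
  (fun (c : bool) (x : 'rV[C]_3) => 0 : C)
  (fun (c : bool) (x : 'rV[C]_3) => 0 : C).
Qed.
Definition e1 : poisson := Poisson e1_poisson.

Lemma e2_poisson : is_poisson (on_charts
  (fun z u1 u2 => (u1 * u2) *: wedge 1 2)
  (fun xi v1 v2 => (v1 * v2) *: wedge 1 2)).
Proof.
poisson_charts
  (fun (c : bool) (x : 'rV[C]_3) => (if c then x 0 1 * x 0 2 else x 0 1 * x 0 2) : C)
  (fun (c : bool) (x : 'rV[C]_3) => 0 : C)
  (fun (c : bool) (x : 'rV[C]_3) => 0 : C).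
Qed.
Definition e2 : poisson := Poisson e2_poisson.

Lemma e3_poisson : is_poisson (on_charts
  (fun z u1 u2 => wedge 2 0)
  (fun xi v1 v2 => - (3 * xi ^+ 2 * v1) *: wedge 1 2 - xi ^+ 3 *: wedge 2 0)).
Proof.
poisson_charts
  (fun (c : bool) (x : 'rV[C]_3) => (if c then 0 else - (3 * x 0 0 ^+ 2 * x 0 1)) : C)
  (fun (c : bool) (x : 'rV[C]_3) => (if c then 1 else - x 0 0 ^+ 3) : C)
  (fun (c : bool) (x : 'rV[C]_3) => 0 : C).
Qed.
Definition e3 : poisson := Poisson e3_poisson.

Lemma e4_poisson : is_poisson (on_charts
  (fun z u1 u2 => z *: wedge 2 0)
  (fun xi v1 v2 => - (3 * xi * v1) *: wedge 1 2 - xi ^+ 2 *: wedge 2 0)).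
Proof.
poisson_charts
  (fun (c : bool) (x : 'rV[C]_3) => (if c then 0 else - (3 * x 0 0 * x 0 1)) : C)
  (fun (c : bool) (x : 'rV[C]_3) => (if c then x 0 0 else - x 0 0 ^+ 2) : C)
  (fun (c : bool) (x : 'rV[C]_3) => 0 : C).
Qed.
Definition e4 : poisson := Poisson e4_poisson.

Lemma e5_poisson : is_poisson (on_charts
  (fun z u1 u2 => z ^+ 2 *: wedge 2 0)
  (fun xi v1 v2 => - (3 * v1) *: wedge 1 2 - xi *: wedge 2 0)).
Proof.
poisson_charts
  (fun (c : bool) (x : 'rV[C]_3) => (if c then 0 else - (3 * x 0 1)) : C)
  (fun (c : bool) (x : 'rV[C]_3) => (if c then x 0 0 ^+ 2 else - x 0 0) : C)
  (fun (c : bool) (x : 'rV[C]_3) => 0 : C).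
Qed.
Definition e5 : poisson := Poisson e5_poisson.

Lemma e7_poisson : is_poisson (on_charts
  (fun z u1 u2 => u1 *: wedge 0 1)
  (fun xi v1 v2 => (xi * v1 * v2) *: wedge 1 2 - (xi ^+ 2 * v1) *: wedge 0 1)).
Proof.
poisson_charts
  (fun (c : bool) (x : 'rV[C]_3) => (if c then 0 else x 0 0 * x 0 1 * x 0 2) : C)
  (fun (c : bool) (x : 'rV[C]_3) => 0 : C)
  (fun (c : bool) (x : 'rV[C]_3) => (if c then x 0 1 else - (x 0 0 ^+ 2 * x 0 1)) : C).
Qed.
Definition e7 : poisson := Poisson e7_poisson.

Lemma e8_poisson : is_poisson (on_charts
  (fun z u1 u2 => (z * u1) *: wedge 0 1)
  (fun xi v1 v2 => (v1 * v2) *: wedge 1 2 - (xi * v1) *: wedge 0 1)).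
Proof.
poisson_charts
  (fun (c : bool) (x : 'rV[C]_3) => (if c then 0 else x 0 1 * x 0 2) : C)
  (fun (c : bool) (x : 'rV[C]_3) => 0 : C)
  (fun (c : bool) (x : 'rV[C]_3) => (if c then x 0 0 * x 0 1 else - (x 0 0 * x 0 1)) : C).
Qed.
Definition e8 : poisson := Poisson e8_poisson.

Lemma e10_poisson : is_poisson (on_charts
  (fun z u1 u2 => u2 *: wedge 2 0)
  (fun xi v1 v2 => - (3 * xi * v1 * v2) *: wedge 1 2 - (xi ^+ 2 * v2) *: wedge 2 0)).
Proof.
poisson_charts
  (fun (c : bool) (x : 'rV[C]_3) => (if c then 0 else - (3 * x 0 0 * x 0 1 * x 0 2)) : C)
  (fun (c : bool) (x : 'rV[C]_3) => (if c then x 0 2 else - (x 0 0 ^+ 2 * x 0 2)) : C)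
  (fun (c : bool) (x : 'rV[C]_3) => 0 : C).
Qed.
Definition e10 : poisson := Poisson e10_poisson.

Lemma e11_poisson : is_poisson (on_charts
  (fun z u1 u2 => (z * u2) *: wedge 2 0)
  (fun xi v1 v2 => - (3 * v1 * v2) *: wedge 1 2 - (xi * v2) *: wedge 2 0)).
Proof.
poisson_charts
  (fun (c : bool) (x : 'rV[C]_3) => (if c then 0 else - (3 * x 0 1 * x 0 2)) : C)
  (fun (c : bool) (x : 'rV[C]_3) => (if c then x 0 0 * x 0 2 else - (x 0 0 * x 0 2)) : C)
  (fun (c : bool) (x : 'rV[C]_3) => 0 : C).
Qed.
Definition e11 : poisson := Poisson e11_poisson.

Lemma e13_poisson : is_poisson (on_charts
  (fun z u1 u2 => (u1 * u2) *: wedge 0 1)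
  (fun xi v1 v2 => (v1 * v2 ^+ 2) *: wedge 1 2 - (xi * v1 * v2) *: wedge 0 1)).
Proof.
poisson_charts
  (fun (c : bool) (x : 'rV[C]_3) => (if c then 0 else x 0 1 * x 0 2 ^+ 2) : C)
  (fun (c : bool) (x : 'rV[C]_3) => 0 : C)
  (fun (c : bool) (x : 'rV[C]_3) => (if c then x 0 1 * x 0 2 else - (x 0 0 * x 0 1 * x 0 2)) : C).
Qed.
Definition e13 : poisson := Poisson e13_poisson.

Definition degeneracy (s : poisson) : set W3 :=
  [set p | exists c x, p = chart c x /\ \rank (s c x) = 0%N].

(* A plaque is a parametrisation, by the open set [pdom], of a piece of a
   submanifold of W3; an atlas of plaques gives an immersed submanifold, namely
   the union of the images with the (finer) manifold structure of the atlas. *)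
Record plaque (k : nat) := Plaque {
  pdom : set 'rV[C]_k;
  pmap : 'rV[C]_k -> W3 }.

Definition holo_lift k (phi : 'rV[C]_k -> W3) c (f : 'rV[C]_k -> 'rV[C]_3)
    (x : 'rV[C]_k) : Prop :=
  \forall y \near x, phi y = chart c (f y) /\ differentiable f y.

Definition immersion k (P : plaque k) : Prop :=
  forall x, pdom P x ->
    exists c f, holo_lift (pmap P) c f x /\ row_free ('J f x).

Definition overlap k (P Q : plaque k) : set 'rV[C]_k :=
  pdom P `&` pmap P @^-1` (pmap Q @` pdom Q).

Definition holo_transition k (P Q : plaque k) : Prop :=
  open (overlap P Q) /\
  exists t : 'rV[C]_k -> 'rV[C]_k, forall x, overlap P Q x ->
    [/\ pdom Q (t x), pmap Q (t x) = pmap P x & differentiable t x].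

Definition carrier k (A : set (plaque k)) : set W3 :=
  \bigcup_(P in A) (pmap P @` pdom P).

Definition immersed_submanifold k (A : set (plaque k)) : Prop :=
  (forall P, A P -> [/\ open (pdom P), set_inj (pdom P) (pmap P) & immersion P])
  /\ (forall P Q, A P -> A Q -> holo_transition P Q).

Definition leaf_open k (A : set (plaque k)) (S : set W3) : Prop :=
  S `<=` carrier A /\
  forall P, A P -> open (pdom P `&` pmap P @^-1` S).

Definition leaf_connected k (A : set (plaque k)) : Prop :=
  carrier A !=set0 /\
  forall S T, leaf_open A S -> leaf_open A T ->
    S `|` T = carrier A -> S `&` T = set0 -> S = set0 \/ T = set0.

(* The bivector is the push-forward of a nondegenerate bivector w of the
   submanifold (whose inverse is then the symplectic form). *)
Definition symplectic (s : poisson) k (A : set (plaque k)) : Prop :=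
  forall P, A P -> forall x, pdom P x ->
    forall c f, holo_lift (pmap P) c f x ->
      exists w : 'M[C]_k, [/\ w \in unitmx, w^T = - w &
        s c (f x) = ('J f x)^T *m w *m 'J f x].

Definition connected_symplectic_submanifold (s : poisson) k
    (A : set (plaque k)) : Prop :=
  [/\ immersed_submanifold A, leaf_connected A & symplectic s A].

Definition symplectic_leaf (s : poisson) k (A : set (plaque k)) : Prop :=
  connected_symplectic_submanifold s A /\
  forall k' (B : set (plaque k')), connected_symplectic_submanifold s B ->
    carrier A `<=` carrier B -> carrier B = carrier A.

Definition leaf_through (s : poisson) (p : W3) k (A : set (plaque k)) : Prop :=
  [/\ symplectic_leaf s A, carrier A p &
    forall k' (B : set (plaque k')), symplectic_leaf s B -> carrier B p ->
      k' = k /\ carrier B = carrier A].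

Definition generic_leaves (s : poisson) (Q : set (plaque 2) -> Prop) : Prop :=
  exists O : set W3, [/\ open O, dense O &
    forall p, O p -> exists A : set (plaque 2), leaf_through s p A /\ Q A].

(* For open M: a biholomorphism from M onto the submanifold A is a bijection phi
   such that phi and its inverse are holomorphic in the plaques of A. *)
Definition isomorphic_to k (M : set 'rV[C]_k) (A : set (plaque k)) : Prop :=
  exists phi : 'rV[C]_k -> W3,
    [/\ set_inj M phi, phi @` M = carrier A &
      forall P, A P -> holo_transition (Plaque M phi) P /\
                       holo_transition P (Plaque M phi)].

Definition CstarxC : set 'rV[C]_2 := [set x : 'rV[C]_2 | x 0 0 != 0].
Definition CstarxCstar : set 'rV[C]_2 :=
  [set x : 'rV[C]_2 | x 0 0 != 0 /\ x 0 1 != 0].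

Definition constant_u (i : 'I_3) k (A : set (plaque k)) : Prop :=
  exists a, carrier A `<=` [set chart true x | x in [set x : 'rV[C]_3 | x 0 i = a]].

End W3.

Arguments CstarxC : clear implicits.
Arguments CstarxCstar : clear implicits.

(* Main.v *)
Require Import Defs.
From mathcomp Require Import all_boot all_order all_algebra.
From mathcomp Require Import generic_quotient complex.
From mathcomp Require Import all_classical all_reals all_analysis.
From mathcomp Require Import ring.

(** On the chart U each of the ten structures is a monomial multiple of one of
    d_1 /\ d_2, d_2 /\ d_0, d_0 /\ d_1, so one of the coordinates z, u1, u2
    (the one whose direction is missing) is a Casimir function.  The symplectic
    leaf of a generic point is the nondegenerate part of the level set of that
    coordinate: a plane with zero, one or two coordinate lines removed, which
    [slice_plaque] parametrises by a single plaque.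

    A degeneracy locus is read off the three coefficients of the bivector in each
    chart ([degeneracyE]).  At a point of it, the rank of the bivector forces a
    symplectic submanifold to have dimension 0 ([carrier_rank]), and a connected
    0-dimensional submanifold is a point, so the point is its own leaf
    ([degenerate_leaf]).

    For the 2-dimensional leaves, existence amounts to connectedness of the
    punctured plane ([punctured_connected]) together with the fact that a skew
    matrix of size 3 killing one basis vector comes from a skew matrix of size 2
    ([skew_slice]).  For maximality, let B be a connected symplectic submanifold
    through a point of the level set A.  Its tangent spaces are the images of the
    bivector, which the differential of a Casimir annihilates; so a Casimir is
    locally constant along B.  Hence the part of B inside A is open and closed in
    the leaf topology of B, and is all of B ([submanifold_in_casimir_level]).
    Casimirs enter only locally, near each nondegenerate point, because z and
    u2 = v2 / xi have poles on the fibre xi = 0.  There 1 / z = xi and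
    1 / u2 = xi / v2 take over; these Casimirs are maps to the projective line,
    and their indeterminacy points are degenerate.  The level sets of z, u1 and u2
    are treated in [generic_level_z], [generic_level_u1] and [generic_level_u2].

    The generic points are those with three nonzero coordinates.  This condition
    is the same in both charts, so they form a dense open set [torus]. *)

Set Implicit Arguments.
Unset Strict Implicit.
Unset Printing Implicit Defensive.

Import Order.TTheory GRing.Theory Num.Theory.
Import numFieldNormedType.Exports.

Local Open Scope classical_set_scope.
Local Open Scope ring_scope.

(** * Jacobians and nonvanishing coordinates *)

Section Jacobian.
Variable K : numFieldType.

Lemma jacobian_comp m n p (f : 'rV[K]_m -> 'rV[K]_n) (g : 'rV[K]_n -> 'rV[K]_p)
    (x : 'rV[K]_m) :
  differentiable f x -> differentiable g (f x) ->
  'J (g \o f) x = 'J f x *m 'J g (f x).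
Proof.
move=> df dg; apply/row_matrixP => i; rewrite !rowE mulmxA /jacobian.
by rewrite !mul_rV_lin1 diff_comp.
Qed.

Lemma near_eq_jacobian m n (f g : 'rV[K]_m -> 'rV[K]_n) (x : 'rV[K]_m) :
  {near x, f =1 g} -> differentiable f x -> differentiable g x -> 'J f x = 'J g x.
Proof.
move=> fg df dg; apply/row_matrixP => i.
have Ef := etrans (rowE i _) (esym (deriveEjacobian (delta_mx 0 i) df)).
have Eg := etrans (rowE i _) (esym (deriveEjacobian (delta_mx 0 i) dg)).
exact: etrans Ef (etrans (near_eq_derive (delta_mx 0 i) fg) (esym Eg)).
Qed.

Lemma near_coord_neq0 n (x : 'rV[K]_n) j :
  x 0 j != 0 -> \forall y \near x, (y : 'rV[K]_n) 0 j != 0.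
Proof.
move=> x0; have c : (fun y : 'rV[K]_n => y 0 j : K^o) @ x --> (x 0 j : K^o).
  exact: coord_continuous.
exact: cvgr_neq0 c x0.
Qed.

Lemma jacobian_id n (x : 'rV[K]_n) : 'J (idfun : 'rV[K]_n -> 'rV[K]_n) x = 1%:M.
Proof.
apply/row_matrixP => i; apply: etrans (rowE i _) _; rewrite rowE mulmx1.
by rewrite /jacobian mul_rV_lin1 (@diff_val _ _ _ _ _ _ _ (is_diff_id x)).
Qed.

(** By the chain rule, a left inverse of a map near a point inverts the Jacobian. *)
Lemma jacobian_unitmx n (f g : 'rV[K]_n -> 'rV[K]_n) (x : 'rV[K]_n) :
  {near x, g \o f =1 idfun} -> differentiable f x -> differentiable g (f x) ->
  'J f x \in unitmx.
Proof.
move=> e df dg; have J1 := jacobian_comp df dg.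
have J2 := near_eq_jacobian e (differentiable_comp df dg)
  (@ex_diff _ _ _ _ _ _ _ (is_diff_id x)).
have J := etrans (esym J1) (etrans J2 (jacobian_id x)).
have [uf _] := mulmx1_unit J; exact: uf.
Qed.

End Jacobian.

(** * Gluing of the two charts *)

Section Charts.
Variable R : realType.
Local Notation C := (Cplx R).
Implicit Types (s : poisson R) (x y : 'rV[C]_3).

(** The only identifications are the gluing ones, so each chart is injective and
    a point seen in both charts is related to itself by [transition]. *)
Lemma chart_eq c x c' x' : chart c x = chart c' x' <->
  (c = c' /\ x = x') \/ [/\ c' = ~~ c, x 0 0 != 0 & x' = transition x].
Proof.
have -> : (chart c x = chart c' x') <-> Defs.glue (c, x) (c', x').
  rewrite /chart; split => [|h].
    by move=> /eqmodP.
  by apply/eqmodP.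
rewrite /Defs.glue /=; split.
  case/orP=> [/eqP[-> ->]|/and3P[cc x0 /eqP xE]]; first by left.
  by right; split => //; case: c c' cc => -[].
case=> [[-> ->]|[-> x0 ->]]; first by rewrite eqxx.
by apply/orP; right; apply/and3P; split; rewrite ?eqxx //; case: c.
Qed.

Lemma chart_inj c : injective (@chart R c).
Proof. by move=> x y /chart_eq [[_ ->]|[]] //; case: c. Qed.

Lemma chart_transition c x : x 0 0 != 0 -> chart (~~ c) (transition x) = chart c x.
Proof. by move=> x0; apply/esym/chart_eq; right. Qed.

Lemma poisson_transition s c x : x 0 0 != 0 ->
  s (~~ c) (transition x) = ('J (@transition R) x)^T *m s c x *m 'J (@transition R) x.
Proof. by case: (coefP s) => _ _ h _; apply: h. Qed.

Lemma has_partials_ext x (f g : 'rV[C]_3 -> C) df :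
  f =1 g -> has_partials x g df -> has_partials x f df.
Proof. by move=> /funext ->. Qed.

Lemma differentiable_transition x : x 0 0 != 0 -> differentiable (@transition R) x.
Proof.
move=> x0.
have h j : exists df, has_partials x (fun y => transition y 0 j) df.
  elim/(@ord3P): j.
  - eexists; apply: (has_partials_ext (g := fun y => (y 0 0)^-1)).
      by move=> y; rewrite /transition vec3E.
    by apply: hp_inv => //; apply: hp_coord.
  - eexists; apply: (has_partials_ext (g := fun y => y 0 0 ^+ 3 * y 0 1)).
      by move=> y; rewrite /transition vec3E.
    by apply: hp_mul; [apply: hp_exp|]; apply: hp_coord.
  - eexists; apply: (has_partials_ext (g := fun y => (y 0 0)^-1 * y 0 2)).
      by move=> y; rewrite /transition vec3E.
    by apply: hp_mul; [apply: hp_inv => //|]; apply: hp_coord.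
have -> : @transition R = \sum_j (fun y => transition y 0 j *: delta_mx 0 j).
  by apply/funext => y; rewrite fct_sumE [LHS]row_sum_delta.
by apply: differentiable_sum => i; apply: differentiableZl; case: (h i) => ? [].
Qed.

Lemma jacobian_transition_unit x : x 0 0 != 0 -> 'J (@transition R) x \in unitmx.
Proof.
move=> x0.
apply: (jacobian_unitmx (g := @transition R)).
- by apply: filterS (near_coord_neq0 x0) => y; exact: transitionK.
- exact: differentiable_transition.
- exact/differentiable_transition/transition_neq0.
Qed.

End Charts.

(** * The rank along a symplectic submanifold *)

Section Rank.
Variable R : realType.
Local Notation C := (Cplx R).
Implicit Types s : poisson R.

Lemma mxrank_congruence (F : fieldType) m n (J : 'M[F]_(m, n)) (A : 'M[F]_m) :
  row_free J -> \rank (J^T *m A *m J) = \rank A.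
Proof.
move=> fJ; rewrite mxrankMfree // -mxrank_tr trmx_mul trmxK mxrankMfree //.
exact: mxrank_tr.
Qed.

(** The transition acts on the matrix of a bivector by a congruence, so the rank
    is a function on W3. *)
Lemma rank_chart s c (x : 'rV[C]_3) c' x' :
  chart c x = chart c' x' -> \rank (s c x) = \rank (s c' x').
Proof.
move=> /chart_eq [[-> ->] //|[-> x0 ->]]; rewrite poisson_transition //.
by rewrite mxrank_congruence // row_free_unit jacobian_transition_unit.
Qed.

(** Lifts of the same plaque to the two charts differ by [transition], whose
    Jacobian M acts at once on tangent vectors and on bivectors.  It follows that
    being immersed or symplectic can be tested on a single lift. *)
Lemma lift_change k (phi : 'rV[C]_k -> W3 R) c f c' f' (x : 'rV[C]_k) :
  holo_lift phi c f x -> holo_lift phi c' f' x ->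
  exists M : 'M[C]_3, [/\ M \in unitmx, 'J f' x = 'J f x *m M &
    forall s, s c' (f' x) = M^T *m s c (f x) *m M].
Proof.
move=> hf hf'.
have hc : \forall y \near x, chart c (f y) = chart c' (f' y).
  by apply: filterS2 hf hf' => y [<- _] [<- _].
have [_ df] := nbhs_singleton hf; have [_ df'] := nbhs_singleton hf'.
have [cc|cc] := eqVneq c' c.
  exists 1%:M; split; first exact: unitmx1.
    rewrite mulmx1; apply: near_eq_jacobian => //.
    by apply: filterS hc => y; rewrite cc => /chart_inj.
  have -> : f' x = f x.
    by have := nbhs_singleton hc; rewrite cc => /chart_inj.
  by move=> s; rewrite cc trmx1 mul1mx mulmx1.
have ht : \forall y \near x, [/\ c' = ~~ c, f y 0 0 != 0 & f' y = transition (f y)].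
  by apply: filterS hc => y /chart_eq [[/esym /eqP]|//]; rewrite (negPf cc).
have [cE x0 f'E] := nbhs_singleton ht.
exists ('J (@transition R) (f x)); split.
- exact: jacobian_transition_unit.
- have dt := differentiable_transition x0.
  have J1 := jacobian_comp df dt.
  suff e : {near x, f' =1 @transition R \o f}.
    exact: etrans (near_eq_jacobian e df' (differentiable_comp df dt)) J1.
  by apply: filterS ht => y [].
- by move=> s; rewrite cE f'E poisson_transition.
Qed.

Lemma symplectic_rank s k (P : plaque R k) (A : set (plaque R k)) (x : 'rV[C]_k)
    c (y : 'rV[C]_3) :
  symplectic s A -> A P -> immersion P -> pdom P x -> Defs.pmap P x = chart c y ->
  \rank (s c y) = k.
Proof.
move=> sA AP iP Px xy; have [c0 [f [hf fJ]]] := iP x Px.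
have [xf _] := nbhs_singleton hf.
have [w [wu _ sw]] := sA P AP x Px c0 f hf.
rewrite -(rank_chart s (etrans (esym xf) xy)) sw mxrank_congruence //.
exact: mxrank_unit.
Qed.

(** The bivector is J^T w J with w invertible and J of full row rank, so its rank is
    the dimension of the submanifold. *)
Lemma carrier_rank s k (A : set (plaque R k)) c (x : 'rV[C]_3) :
  connected_symplectic_submanifold s A -> carrier A (chart c x) ->
  \rank (s c x) = k.
Proof.
move=> [[iA _] _ sA] [P AP [y Py yx]]; have [_ _ iP] := iA P AP.
exact: symplectic_rank sA AP iP Py yx.
Qed.

End Rank.

(** * Leaves at degenerate points *)

Section PointLeaf.
Variable R : realType.
Local Notation C := (Cplx R).
Implicit Types s : poisson R.

(** A space with one point is discrete. *)
Lemma open_rV0 (D : set 'rV[C]_0) : open D.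
Proof.
have [->|/set0P[x Dx]] := eqVneq D set0; first exact: open0.
rewrite (_ : D = setT); first exact: openT.
by apply/seteqP; split => // y _; rewrite [y]thinmx0 -[0](thinmx0 x).
Qed.

Lemma connected_carrier0 (B : set (plaque R 0)) p :
  leaf_connected B -> carrier B p -> carrier B = [set p].
Proof.
move=> [_ cB] Bp.
have [||||/seteqP[+ _]|BpE] := cB [set p] (carrier B `\ p).
- by split => [q ->//|P BP]; apply: open_rV0.
- by split => [q []//|P BP]; apply: open_rV0.
- by rewrite setDUK // => q ->.
- by apply/seteqP; split => q // [-> [_ []]].
- by move=> h; have := h p erefl.
- apply/seteqP; split => [q Bq|q ->//]; apply: contrapT => qp.
  by have : (carrier B `\ p) q by []; rewrite BpE.
Qed.

Definition point_plaque (p : W3 R) : plaque R 0 := Plaque setT (fun=> p).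

Lemma carrier_point p : carrier [set point_plaque p] = [set p].
Proof.
rewrite /carrier bigcup_set1 /=; apply/seteqP; split => [q [x _ <-] //|q ->].
by exists 0.
Qed.

(** Where the bivector vanishes, every symplectic submanifold has dimension 0, and
    by connectedness it is a single point.  This gives both the maximality and the
    uniqueness of the leaf. *)
Lemma degenerate_leaf s p : degeneracy s p ->
  exists A : set (plaque R 0), leaf_through s p A /\ carrier A = [set p].
Proof.
move=> [c [x [px rx]]]; exists [set point_plaque p].
have cA : connected_symplectic_submanifold s [set point_plaque p].
  split.
  - split=> [P -> | P Q -> ->].
      split; [exact: openT | by move=> u v _ _ _; rewrite [u]thinmx0 [v]thinmx0|].
      move=> u _; exists c, (fun=> x); split; last by rewrite /row_free mxrank.unlock.
      by apply: (@filterE _ _ (nbhs_filter u)) => v; split => //; exact: differentiable_cst.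
    split; first exact: open_rV0.
    by exists id => y _; split => //; apply: ex_diff.
  - split; first by exists p; rewrite carrier_point.
    rewrite carrier_point => S T _ _ SuT SiT.
    have [Sp|nSp] := pselect (S p); [right|left]; apply/seteqP; split => q //.
      move=> Tq; have qp : q = p by have : (S `|` T) q by [right]; rewrite SuT.
      by have : (S `&` T) p by [split => //; rewrite -qp]; rewrite SiT.
    move=> Sq; have qp : q = p by have : (S `|` T) q by [left]; rewrite SuT.
    by case: nSp; rewrite -qp.
  - move=> P -> u _ c' f hf; exists 1%:M; split; first exact: unitmx1.
      by apply/matrixP => -[].
    have [pf _] := nbhs_singleton hf.
    have /eqP := rank_chart s (etrans (esym pf) px); rewrite rx mxrank_eq0 => /eqP ->.
    by rewrite (thinmx0 ('J f u)^T) !mul0mx.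
have BE k (B : set (plaque R k)) : connected_symplectic_submanifold s B ->
    carrier B p -> k = 0%N /\ carrier B = [set p].
  move=> cB Bp; have k0 : k = 0%N.
    by rewrite -(carrier_rank (c := c) (x := x) cB) -?px.
  by subst k; split => //; case: cB => _ cB _; apply: connected_carrier0.
split; last exact: carrier_point.
split; last 2 first.
- by rewrite carrier_point.
- by move=> k B [cB _] Bp; rewrite carrier_point; apply: BE.
split=> // k B cB; rewrite carrier_point => h.
by have [_ ->] := BE k B cB (h p erefl).
Qed.

End PointLeaf.

(** * Holomorphic functions with zero derivative *)

Section LocallyConstant.
Variable R : realType.
Local Notation C := (Cplx R).
Local Open Scope complex_scope.

Lemma near_real_complex (P : C -> Prop) :
  (\forall h \near (0 : C)^', P h) -> \forall h \near (0 : R)^', P (h%:C : C).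
Proof.
move=> /nbhs_ballP [d /= d0 hd].
(* A positive complex number, here the radius of a ball, is real. *)
have [r dE] : exists r : R, d = (r%:C : C).
  by apply/complex_realP; exact: gtr0_real.
rewrite dE ltcR in d0; apply/nbhs_ballP; exists r => // h.
rewrite -ball_normE /= sub0r normrN => hr h0; apply: hd.
  rewrite -ball_normE /= sub0r normrN dE.
  rewrite normc_def /= expr0n /= addr0 sqrtr_sqr.
  by rewrite ltcR.
by apply: contra_neq h0 => -[].
Qed.

(** Real parts along real lines reduce a complex derivative to a real one, to
    which the mean value theorem applies. *)
Lemma is_derive_Re_line (V : normedModType C) (g : V -> C) (x v : V) (t : R) :
  derivable g (x + (t%:C : C) *: v) v -> 'D_v g (x + (t%:C : C) *: v) = 0 ->
  is_derive t 1 (fun t : R => complex.Re (g (x + (t%:C : C) *: v))) 0.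
Proof.
set y := x + _ => dg D0.
set psi := fun t : R => _.
have cv : (fun h : R => h^-1 *: (psi (h *: 1 + t) - psi t)) @ 0^' --> (0 : R).
  apply/cvgr0Pnorm_lt => e e0.
  have : (fun h : C => h^-1 *: (g (h *: v + y) - g y)) @ 0^' --> (0 : C).
    have c : (fun h : C => h^-1 *: (g (h *: v + y) - g y)) @ 0^' --> 'D_v g y := dg.
    by rewrite D0 in c.
  move=> /cvgr0Pnorm_lt /(_ (e%:C : C)); rewrite ltcR => /(_ e0).
  move=> /near_real_complex; apply: filterS => h.
  suff -> : h^-1 *: (psi (h *: 1 + t) - psi t) =
      complex.Re ((h%:C : C)^-1 *: (g ((h%:C : C) *: v + y) - g y)).
    by move=> hh; rewrite -ltcR; apply: le_lt_trans hh; exact: normc_ge_Re.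
  have -> : psi (h *: 1 + t) = complex.Re (g ((h%:C : C) *: v + y)).
    by rewrite /psi /y scaler1 rmorphD scalerDl addrCA.
  rewrite /psi -/y.
  have -> : (h%:C : C)^-1 = ((h^-1)%:C : C) by rewrite fmorphV.
  case: (g _) => a b; case: (g _) => a' b'.
  by rewrite /GRing.scale /= mul0r subr0.
apply: DeriveDef.
  by apply/cvg_ex; exists 0.
exact: cvg_lim cv.
Qed.

(** A zero derivative on a ball makes the real part constant on each segment
    from the centre, by the mean value theorem; the imaginary part of g is the
    real part of - i g. *)
Lemma derive0_near_constant (V : normedModType C) (g : V -> C) (x : V) :
  (\forall y \near x, forall v, derivable g y v /\ 'D_v g y = 0) ->
  \forall y \near x, g y = g x.
Proof.
have key (f : V -> C) : (\forall y \near x, forall v, derivable f y v /\ 'D_v f y = 0) ->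
    \forall y \near x, complex.Re (f y) = complex.Re (f x).
  move=> /nbhs_ballP [e e0 he]; apply/nbhs_ballP; exists e => // y.
  rewrite -ball_normE /= => xy.
  pose v := y - x.
  pose psi (t : R) := complex.Re (f (x + (t%:C : C) *: v)).
  have dpsi (t : R) : t \in `[0, 1] -> is_derive t 1 psi 0.
    rewrite in_itv /= => /andP[t0 t1].
    have yb : ball x e (x + (t%:C : C) *: v).
      rewrite -ball_normE /= opprD addrA subrr add0r normrN normrZ.
      apply: le_lt_trans xy; rewrite distrC -/v ler_piMl //.
      by rewrite ger0_norm ?ler0c // -[1]/(1%:C) lecR.
    by have [d0 D0] := he _ yb v; apply: is_derive_Re_line.
  have dpsi' (t : R) : t \in `]0, 1[ -> is_derive t 1 psi 0.
    move=> t01; apply: dpsi; exact: subset_itv_oo_cc t01.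
  have cpsi : {within `[0, 1], continuous psi}.
    by apply: derivable_within_continuous => t /dpsi [].
  have [c _] := MVT_segment (ler01 : (0 : R) <= 1) dpsi' cpsi.
  rewrite mul0r /psi => /eqP; rewrite subr_eq0 scale0r addr0 scale1r.
  by rewrite /v addrC subrK => /eqP.
move=> h; have hi : \forall y \near x, forall v,
    derivable (fun y => - 'i *: g y) y v /\ 'D_v (fun y => - 'i *: g y) y = 0.
  apply: filterS h => y hy v; have [d0 D0] := hy v.
  by split; [exact: derivableZ|rewrite deriveZ // D0 scaler0].
apply: filterS2 (key _ h) (key _ hi) => y.
case: (g y) => a b; case: (g x) => a' b' /= ->.
by rewrite !oppr0 !mul0r !sub0r !mulN1r !opprK => ->.
Qed.

End LocallyConstant.

(** * Casimir functions confine symplectic submanifolds *)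

Section Conormal.
Variable K : numFieldType.

Lemma derive_comp_jacobian m k (f : 'rV[K]_k -> 'rV[K]_m) (H : 'rV[K]_m -> K) y v :
  differentiable f y -> differentiable H (f y) ->
  'D_v (H \o f) y =
    (v *m 'J f y *m \col_l 'D_(delta_mx 0 l) H (f y)) 0 0.
Proof.
move=> df dH; rewrite deriveE; last exact: differentiable_comp.
rewrite diff_comp //=.
have -> : 'd f y v = v *m 'J f y by rewrite /jacobian mul_rV_lin1.
move: (v *m _) => u; rewrite [in LHS](row_sum_delta u) linear_sum mxE.
by apply: eq_bigr => l _; rewrite linearZ mxE deriveE.
Qed.

(** A covector annihilated by the bivector J^T w J of a symplectic submanifold
    vanishes on its tangent space, the row space of J. *)
Lemma mulmx_congruence_eq0 (m k n : nat) (J : 'M[K]_(k, m)) (w : 'M[K]_k)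
    (g : 'M[K]_(m, n)) :
  row_free J -> w \in unitmx -> J^T *m w *m J *m g = 0 -> J *m g = 0.
Proof.
move=> fJ wu; rewrite -mulmxA -mulmxA => e.
have : w *m (J *m g) = 0.
  apply: trmx_inj; apply: (row_free_inj fJ); rewrite trmx0 mul0mx.
  by apply: trmx_inj; rewrite trmx_mul trmxK trmx0.
by move=> /(congr1 (mulmx (invmx w))); rewrite mulKmx // mulmx0.
Qed.

End Conormal.

Section Casimir.
Variable R : realType.
Local Notation C := (Cplx R).
Implicit Types s : poisson R.

Definition casimir_at s c (H : 'rV[C]_3 -> C) (x : 'rV[C]_3) :=
  differentiable H x /\ forall i, \sum_l s c x i l * partial l H x = 0.

(** The Casimir H and its value h may depend on the point: this allows for
    Casimirs with poles, such as z and u2, whose inverses are used instead near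
    those poles. *)
Definition casimir_level s (A : set (W3 R)) c (x : 'rV[C]_3) :=
  exists (H : 'rV[C]_3 -> C) (h : C),
    \forall y \near x, casimir_at s c H y /\ (A (chart c y) <-> H y = h).

(** The tangent space at a point of a symplectic submanifold is the image of the
    bivector, which the differential of a Casimir kills. *)
Lemma casimir_comp_derive0 s c (H : 'rV[C]_3 -> C) k (f : 'rV[C]_k -> 'rV[C]_3) w
    (y : 'rV[C]_k) :
  casimir_at s c H (f y) -> differentiable f y -> row_free ('J f y) ->
  w \in unitmx -> s c (f y) = ('J f y)^T *m w *m 'J f y ->
  forall v, derivable (H \o f) y v /\ 'D_v (H \o f) y = 0.
Proof.
move=> [dH cH] df fJ wu sE v; split.
  by apply: diff_derivable; apply: differentiable_comp.
rewrite (derive_comp_jacobian v df dH) -mulmxA.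
have -> : 'J f y *m \col_l 'D_(delta_mx 0 l) H (f y) = 0.
  apply: (mulmx_congruence_eq0 fJ wu); rewrite -sE.
  apply/matrixP => i j; rewrite !mxE -[RHS](cH i).
  by apply: eq_bigr => l _; rewrite mxE.
by rewrite mulmx0 mxE.
Qed.

Lemma lift_row_free k (P : plaque R k) c f (y : 'rV[C]_k) :
  immersion P -> pdom P y -> holo_lift (Defs.pmap P) c f y -> row_free ('J f y).
Proof.
move=> iP Py hf; have [c' [f' [hf' fJ]]] := iP y Py.
have [M [Mu JE _]] := lift_change hf' hf.
by rewrite JE /row_free mxrankMfree // row_free_unit.
Qed.

(** Locally along B, the defining Casimir of A is constant, so membership in A is
    locally constant for the leaf topology of B; conclude by connectedness. *)
Lemma submanifold_in_casimir_level s (A : set (W3 R)) k (B : set (plaque R k)) :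
  connected_symplectic_submanifold s B ->
  (forall c x, carrier B (chart c x) -> casimir_level s A c x) ->
  carrier B `&` A !=set0 -> carrier B `<=` A.
Proof.
move=> [[iB _] [_ cB] sB] hA [p [Bp Ap]].
have key P x : B P -> pdom P x ->
    \forall y \near x, pdom P y /\ (A (Defs.pmap P y) <-> A (Defs.pmap P x)).
  move=> BP Px; have [oP _ iP] := iB P BP.
  have [c [f [hf _]]] := iP x Px.
  have [xf df] := nbhs_singleton hf.
  have Bf : carrier B (chart c (f x)) by rewrite -xf; exists P => //; exists x.
  have [H [h nH]] := hA c (f x) Bf.
  have nPx : \forall y \near x, pdom P y by apply: open_nbhs_nbhs.
  have nHf : \forall y \near x, casimir_at s c H (f y) /\ (A (chart c (f y)) <-> H (f y) = h).
    exact: (differentiable_continuous df) nH.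
  (* The lift f stays a lift at the points y near x, where the symplectic
     condition applies to it again. *)
  have nc : \forall y \near x, (H \o f) y = (H \o f) x.
    apply: derive0_near_constant.
    have hfx : \forall y \near x, holo_lift (Defs.pmap P) c f y by exact: nbhs_interior hf.
    near=> y => v.
    have Py : pdom P y by near: y.
    have hy : holo_lift (Defs.pmap P) c f y by near: y.
    have [cH _] : casimir_at s c H (f y) /\ (A (chart c (f y)) <-> H (f y) = h) by near: y.
    have [_ dfy] := nbhs_singleton hy.
    have [w [wu _ sE]] := sB P BP y Py c f hy.
    exact: casimir_comp_derive0 cH dfy (lift_row_free iP Py hy) wu sE v.
  near=> y; split; first by near: y.
  have [-> _] : Defs.pmap P y = chart c (f y) /\ differentiable f y by near: y.
  have [_ ->] : casimir_at s c H (f y) /\ (A (chart c (f y)) <-> H (f y) = h) by near: y.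
  have [_] := nbhs_singleton nHf; rewrite -xf => ->.
  by have -> : H (f y) = H (f x) by near: y.
have oA D : (D = A \/ D = ~` A) -> leaf_open B (carrier B `&` D).
  move=> DA; split=> [q []//|P BP]; rewrite openE => x [Px [_ Dx]].
  apply: filterS (key P x BP Px) => y [Py yx]; split => //; split.
    by exists P => //; exists y.
  by case: DA Dx => -> /=; rewrite yx.
have [||||/seteqP[+ _]|/seteqP[+ _] q Bq] := cB (carrier B `&` A) (carrier B `&` ~` A).
- by apply: oA; left.
- by apply: oA; right.
- by rewrite -setIUr setUCr setIT.
- by rewrite setIACA setICr setI0.
- by move=> /(_ p) [].
- by move=> /(_ q) h; apply: contrapT => Aq; case: h.
Unshelve. all: by end_near. Qed.

End Casimir.

(** * Punctured planes are connected *)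

Section SegmentConnected.
Variable R : realType.
Local Notation C := (Cplx R).
Local Open Scope complex_scope.

Lemma continuous_real_complex : continuous (fun t : R => t%:C : C).
Proof.
move=> t; apply/cvgrPdist_lt => e e0.
have [r eE] : exists r : R, e = (r%:C : C).
  by apply/complex_realP; exact: gtr0_real.
rewrite eE ltcR in e0 *; apply/nbhs_ballP; exists r => // u.
rewrite /ball_ /= => tu.
by rewrite -rmorphB normc_def /= expr0n /= addr0 sqrtr_sqr ltcR.
Qed.

Definition on_segment (V : normedModType C) (x y : V) (t : R) : V :=
  x + (t%:C : C) *: (y - x).

Lemma connected_segment (V : normedModType C) (x y : V) :
  connected (on_segment x y @` `[0, 1]).
Proof.
apply: connected_continuous_connected; first exact: segment_connected.
apply: continuous_subspaceT => t; apply: cvgD; first exact: cvg_cst.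
apply: cvgZr_tmp; exact: continuous_real_complex.
Qed.

(** A relatively clopen subset contains, with the origin of a segment lying in M,
    its end point; two segments then reach any point. *)
Lemma two_segments_connected (V : normedModType C) (M : set V) :
  (forall x y, M x -> M y -> exists m, forall t : R, t \in `[0, 1] ->
    M (on_segment x m t) /\ M (on_segment m y t)) ->
  connected M.
Proof.
move=> hM B [x Bx] [D1 oD1 BE1] [D2 cD2 BE2].
have sub y z : B y -> (forall t : R, t \in `[0, 1] -> M (on_segment y z t)) -> B z.
  move=> By yz; have cs := @connected_segment V y z.
  have yS : (on_segment y z @` `[0, 1]) y.
    by exists 0; rewrite /= ?in_itv /= ?lexx ?ler01 // /on_segment scale0r addr0.
  have zS : (on_segment y z @` `[0, 1]) z.
    exists 1; first by rewrite /= in_itv /= lexx ler01.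
    by rewrite /on_segment scale1r addrC subrK.
  have SM : on_segment y z @` `[0, 1] `<=` M by move=> _ [t t01 <-]; exact: yz.
  have SB D : B = M `&` D ->
      (on_segment y z @` `[0, 1]) `&` B = (on_segment y z @` `[0, 1]) `&` D.
    by move=> ->; rewrite setIA (setIidl SM).
  have SE : (on_segment y z @` `[0, 1]) `&` B = on_segment y z @` `[0, 1].
    apply: cs; first by exists y.
      by exists D1 => //; apply: SB.
    by exists D2 => //; apply: SB.
  by have [] : ((on_segment y z @` `[0, 1]) `&` B) z by rewrite SE.
apply/seteqP; split => [|y My]; first by rewrite BE1 => ? [].
have Mx : M x by move: Bx; rewrite BE1 => -[].
have [m hm] := hM x y Mx My.
by apply: (sub m); [apply: (sub x) => // t /hm []|move=> t /hm []].
Qed.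

(** The segment from p to q meets 0 only if q is a negative multiple of p, and then
    the detour through i p avoids 0. *)
Lemma avoid_zero (p q : C) : p != 0 -> q != 0 ->
  exists m : C, forall t : R, t \in `[0, 1] ->
    p + (t%:C : C) * (m - p) != 0 /\ m + (t%:C : C) * (q - m) != 0.
Proof.
move=> p0 q0.
have [[t [t01 pq]]|h] :=
    pselect (exists t : R, t \in `[0, 1] /\ p + (t%:C : C) * (q - p) = 0); last first.
  exists q => t t01; split; last by rewrite subrr mulr0 addr0.
  by apply/negP => /eqP pq; apply: h; exists t.
exists ('i * p : C) => u _.
have [c [c0 qE]] : exists c : R, c != 0 /\ q = - (c%:C : C) * p.
  have t0 : t != 0.
    by apply: contra_neq p0 => t0; rewrite -pq t0 mul0r addr0.
  have qE : q = - (((1 - t) / t)%:C : C) * p.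
    apply: (@mulfI _ (t%:C : C)); first by apply: contra_neq t0 => -[].
    rewrite mulrA mulrN -rmorphM [t * _]mulrC divfK // rmorphB /=.
    by apply/eqP; rewrite -subr_eq0 -pq; apply/eqP; ring.
  exists ((1 - t) / t); split => //; apply: contra_neq q0 => c0.
  by rewrite qE c0 oppr0 mul0r.
split.
  have -> : p + (u%:C : C) * ('i * p - p) = ((1 - u) +i* u : C) * p.
    have -> : ((1 - u) +i* u : C) = 1 - (u%:C : C) + (u%:C : C) * 'i.
      by apply/eqP; rewrite eq_complex /=; apply/andP; split; apply/eqP; ring.
    by ring.
  rewrite mulf_neq0 //; apply/negP => /eqP [+ u0].
  by rewrite u0 subr0 => /eqP; rewrite oner_eq0.
have -> : 'i * p + (u%:C : C) * (q - 'i * p) = ((- (u * c)) +i* (1 - u) : C) * p.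
  have -> : ((- (u * c)) +i* (1 - u) : C) = - (u%:C : C) * (c%:C : C) + (1 - (u%:C : C)) * 'i.
    by apply/eqP; rewrite eq_complex /=; apply/andP; split; apply/eqP; ring.
  by rewrite qE; ring.
rewrite mulf_neq0 //; apply/negP => /eqP [+ /eqP]; rewrite subr_eq0 => + /eqP u1.
by move=> /eqP; rewrite -u1 mul1r oppr_eq0 (negPf c0).
Qed.

(** These are the nonvanishing loci in C^2 of the monomials x^m y^n; the booleans
    record which of the exponents m and n are positive. *)
Definition punctured (b1 b2 : bool) : set 'rV[C]_2 :=
  [set x : 'rV[C]_2 | (b1 -> x 0 0 != 0) /\ (b2 -> x 0 1 != 0)].

Lemma on_segment_coord n (x y : 'rV[C]_n) t j :
  on_segment x y t 0 j = x 0 j + (t%:C : C) * (y 0 j - x 0 j).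
Proof. by rewrite !mxE. Qed.

Lemma punctured_connected b1 b2 : connected (punctured b1 b2).
Proof.
have hC (b : bool) (p q : C) : (b -> p != 0) -> (b -> q != 0) ->
    exists m : C, forall t : R, t \in `[0, 1] ->
      (b -> p + (t%:C : C) * (m - p) != 0) /\ (b -> m + (t%:C : C) * (q - m) != 0).
  case: b => [p0 q0|]; last by exists 0.
  have [m hm] := avoid_zero (p0 isT) (q0 isT).
  by exists m => t /hm [].
apply: two_segments_connected => x y [x0 x1] [y0 y1].
have [m0 h0] := hC b1 _ _ x0 y0; have [m1 h1] := hC b2 _ _ x1 y1.
pose m : 'rV[C]_2 := \row_j [:: m0; m1]`_j.
have mE : (m 0 0 = m0) * (m 0 1 = m1) by rewrite !mxE.
exists m => t t01; have [a0 c0] := h0 t t01; have [a1 c1] := h1 t t01.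
by split; split; rewrite on_segment_coord ?mE.
Qed.

End SegmentConnected.

(** * Coordinate surfaces as symplectic leaves *)

Section Affine.
Variable K : numFieldType.

Lemma differentiable_mulmxr m n (L : 'M[K]_(m, n)) (x : 'rV[K]_m) :
  differentiable (mulmxr L : 'rV[K]_m -> 'rV[K]_n) x.
Proof.
have dk k : differentiable (fun y : 'rV[K]_m => y 0 k *: row k L) x.
  by apply: differentiableZl; exact: differentiable_coord.
have := differentiable_sum dk; set f := (F in differentiable F _) => df.
have -> : (mulmxr L : 'rV[K]_m -> 'rV[K]_n) = f; last exact: df.
by apply/funext => y; rewrite /f fct_sumE /= mulmx_sum_row.
Qed.

Lemma differentiable_affine m n (u : 'rV[K]_n) (L : 'M[K]_(m, n)) (x : 'rV[K]_m) :
  differentiable (fun y => u + y *m L) x.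
Proof.
by apply: differentiableD; [exact: differentiable_cst|exact: differentiable_mulmxr].
Qed.

Lemma diff_affine (V W : normedModType K) (u : W) (f : {linear V -> W}) (x : V) :
  continuous f -> 'd (cst u + f) x = f :> (V -> W).
Proof.
move=> cf; rewrite diffD; [|exact: differentiable_cst|exact: linear_differentiable].
by rewrite diff_cst diff_lin //; apply/funext => v; exact: add0r.
Qed.

Lemma jacobian_affine m n (u : 'rV[K]_n) (L : 'M[K]_(m, n)) (x : 'rV[K]_m) :
  'J (fun y => u + y *m L) x = L.
Proof.
apply/row_matrixP => k; apply: etrans (rowE k _) _; rewrite [RHS]rowE.
rewrite /jacobian mul_rV_lin1.
have cL : continuous (mulmxr L : 'rV[K]_m -> 'rV[K]_n).
  by move=> y; apply: differentiable_continuous; exact: differentiable_mulmxr.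
exact: (congr1 (fun h => h (delta_mx 0 k)) (diff_affine u x cL)).
Qed.

(** A skew matrix of size 2 squares to a scalar, which vanishes only with it. *)
Lemma skew2_unit (w : 'M[K]_2) : w^T = - w -> w != 0 -> w \in unitmx.
Proof.
move=> wT w0.
have E k l : w k l = - w l k.
  by have := congr1 (fun A : 'M[K]_2 => A l k) wT; rewrite !mxE.
have E0 k : w k k = 0.
  by apply/eqP; have /eqP := E k k; rewrite -subr_eq0 opprK -mulr2n mulrn_eq0 /=.
have ord2 (j : 'I_2) : j = 0 \/ j = 1.
  by case: j => [[|[|//]] h]; [left|right]; apply: val_inj.
have w01 : w 0 1 != 0.
  apply: contra_neq w0 => w01; apply/matrixP => k l; rewrite mxE.
  by case: (ord2 k) => ->; case: (ord2 l) => ->; rewrite ?E0 // (E 1 0) w01 oppr0.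
have ww : w *m (- (w 0 1) ^- 2 *: w) = 1%:M.
  apply/matrixP => k l; rewrite mxE big_ord_recl big_ord1 !mxE.
  rewrite (_ : lift ord0 ord0 = 1); last exact: val_inj.
  by case: (ord2 k) => ->; case: (ord2 l) => ->; rewrite !E0 ?(E 1 0) /=; field.
have [uw _] := mulmx1_unit ww; exact: uw.
Qed.

End Affine.

Section Slice.
Variable R : realType.
Local Notation C := (Cplx R).
Implicit Types s : poisson R.

(** The inclusion of C^2 as the coordinate plane that omits the direction i. *)
Definition slice_mx (i : 'I_3) : 'M[C]_(2, 3) := \matrix_(k, j) (lift i k == j)%:R.

Definition slice (i : 'I_3) (a : C) (x : 'rV[C]_2) : 'rV[C]_3 :=
  a *: delta_mx 0 i + x *m slice_mx i.

Lemma differentiable_slice i a x : differentiable (slice i a) x.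
Proof. exact: differentiable_affine. Qed.

Lemma jacobian_slice i a x : 'J (slice i a) x = slice_mx i.
Proof. exact: jacobian_affine. Qed.

Lemma mulmx_slice_mx (i : 'I_3) n (B : 'M[C]_(n, 2)) m :
  ((B *m slice_mx i) m i = 0) * (forall k, (B *m slice_mx i) m (lift i k) = B m k).
Proof.
split=> [|k]; rewrite mxE.
  apply: big1 => k _; rewrite mxE eq_sym (negPf (neq_lift i k)).
  by rewrite mulr0.
rewrite (bigD1 k) //= mxE eqxx mulr1 big1 ?addr0 // => k' kk'.
by rewrite mxE (inj_eq (@lift_inj _ i)) (negPf kk') mulr0.
Qed.

Lemma sliceE i a x : (slice i a x 0 i = a) * (forall k, slice i a x 0 (lift i k) = x 0 k).
Proof.
split=> [|k]; rewrite mxE mulmx_slice_mx !mxE ?eqxx ?mulr1 ?addr0 //.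
by rewrite eq_sym (negPf (neq_lift i k)) /= mulr0 add0r.
Qed.

Lemma lift_case (i : 'I_3) (P : 'I_3 -> Prop) :
  P i -> (forall k : 'I_2, P (lift i k)) -> forall j, P j.
Proof. by move=> Pi Pl j; case: (unliftP i j) => [k ->|->]. Qed.

Lemma sliceK i (a : C) (y : 'rV[C]_3) : y 0 i = a ->
  slice i a (\row_k y 0 (lift i k)) = y.
Proof.
move=> yi; apply/rowP; apply: (lift_case (i := i)) => [|k]; rewrite sliceE //.
by rewrite mxE.
Qed.

Lemma slice_inj i a : injective (slice i a).
Proof.
by move=> x y xy; apply/rowP => k; rewrite -(sliceE i a x).2 xy (sliceE i a y).2.
Qed.

Lemma slice_mxK i : slice_mx i *m (slice_mx i)^T = 1%:M.
Proof.
apply/matrixP => k l; rewrite mxE (bigD1 (lift i k)) //= !mxE eqxx mul1r.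
rewrite (inj_eq (@lift_inj _ i)) eq_sym big1 ?addr0 // => j kj.
by rewrite mxE eq_sym (negPf kj) mul0r.
Qed.

Lemma slice_mx_free i : row_free (slice_mx i).
Proof. by apply/row_freeP; exists (slice_mx i)^T; exact: slice_mxK. Qed.

Lemma slice_mx_proj i (s : 'M[C]_3) : (forall j, s j i = 0) ->
  s *m (slice_mx i)^T *m slice_mx i = s.
Proof.
move=> si0; apply/matrixP => j; apply: (lift_case (i := i)) => [|k].
  by rewrite mulmx_slice_mx si0.
rewrite mulmx_slice_mx mxE (bigD1 (lift i k)) //= !mxE eqxx mulr1 big1 ?addr0 // => l lk.
by rewrite !mxE eq_sym (negPf lk) mulr0.
Qed.

(** A skew matrix killing the direction i is carried by the complementary
    coordinate plane, so it is the push-forward of its restriction. *)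
Lemma skew_slice i (s : 'M[C]_3) : s^T = - s -> (forall j, s j i = 0) ->
  s = (slice_mx i)^T *m (slice_mx i *m s *m (slice_mx i)^T) *m slice_mx i.
Proof.
move=> sT /slice_mx_proj sL; rewrite !mulmxA -[_ *m s *m _ *m _]mulmxA.
rewrite -[_ *m s *m (_ *m _)]mulmxA [s *m (_ *m _)]mulmxA sL.
by apply: trmx_inj; rewrite !trmx_mul trmxK sT mulNmx mulmxA sL.
Qed.

Definition slice_plaque i (a : C) b1 b2 : plaque R 2 :=
  Plaque (@punctured R b1 b2) (chart true \o slice i a).

(** Described inside U alone: a generic level set has no nondegenerate limit point
    on the fibre xi = 0. *)
Definition leaf_set s (i : 'I_3) (a : C) : set (W3 R) :=
  [set chart true y | y in [set y : 'rV[C]_3 | y 0 i = a /\ s true y != 0]].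

Lemma slice_lift i a b1 b2 x :
  holo_lift (Defs.pmap (slice_plaque i a b1 b2)) true (slice i a) x.
Proof.
apply: (@filterE _ _ (nbhs_filter x)) => y; split; first by [].
exact: differentiable_slice.
Qed.

Lemma open_punctured b1 b2 : open (@punctured R b1 b2).
Proof.
rewrite openE => x [x0 x1].
have h (b : bool) j : (b -> x 0 j != 0) ->
      \forall y \near x, b -> (y : 'rV[C]_2) 0 j != 0.
  case: b => [/(_ isT)|_]; first by move=> /near_coord_neq0; apply: filterS.
  exact: (@filterE _ _ (nbhs_filter x)).
by apply: filterS2 (h _ _ x0) (h _ _ x1) => y.
Qed.

Lemma slice_plaque_immersed i a b1 b2 : immersed_submanifold [set slice_plaque i a b1 b2].
Proof.
split=> [P ->|P Q -> ->].
  split; first exact: open_punctured.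
    by move=> x y _ _ /chart_inj /slice_inj.
  move=> x Px; exists true, (slice i a); split; first exact: slice_lift.
  by rewrite jacobian_slice; exact: slice_mx_free.
split.
  rewrite /overlap (_ : _ `&` _ = @punctured R b1 b2); first exact: open_punctured.
  by apply/seteqP; split => [x []//|x Px]; split => //; exists x.
by exists id => x [Px _]; split => //; apply: ex_diff.
Qed.

Lemma connected_plaque k (P : plaque R k) :
  pdom P !=set0 -> connected (pdom P) -> leaf_connected [set P].
Proof.
move=> [x0 Px0] cP; rewrite /leaf_connected /leaf_open /carrier bigcup_set1.
split; first by exists (Defs.pmap P x0); exists x0.
move=> S T [SP oS] [TP oT] ST STI.
have {}oS := oS P erefl; have {}oT := oT P erefl.
have [S0|nS] := eqVneq S set0; [by left|right].
have /set0P[q Sq] := nS; have [x Px xq] := SP q Sq.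
have PS : pdom P `&` (Defs.pmap P @^-1` S) = pdom P.
  apply: cP.
  - by exists x; split => //=; rewrite xq.
  - exists (pdom P `&` (Defs.pmap P @^-1` S)) => //; by rewrite setIA setIid.
  - exists (~` (pdom P `&` (Defs.pmap P @^-1` T))); first exact: open_closedC.
    apply/seteqP; split => y [Py Sy]; split => //.
      move=> [_ Ty]; have : (S `&` T) (Defs.pmap P y) by [].
      by rewrite STI.
    have : (S `|` T) (Defs.pmap P y) by rewrite ST; exists y.
    by case=> // Ty; case: Sy.
apply/seteqP; split => // r Tr; have [y Py yr] := TP r Tr.
have : (pdom P `&` (Defs.pmap P @^-1` S)) y by rewrite PS.
move=> [_ /= Sy]; have /seteqP[ST0 _] := STI.
by apply: (ST0 r); split => //; rewrite -yr.
Qed.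

Lemma near_poisson_neq0 s c x : s c x != 0 -> \forall y \near x, s c y != 0.
Proof.
move=> sx; have [[j l] jl] : exists jl, s c x jl.1 jl.2 != 0.
  apply: contrapT => h; move/eqP: sx; apply; apply/matrixP => j l; rewrite mxE.
  by apply: contrapT => /eqP jl; apply: h; exists (j, l).
have [ds _ _ _] := coefP s.
have cs : (fun y => s c y j l : C^o) @ x --> (s c x j l : C^o).
  exact: (differentiable_continuous (ds c j l x)).
apply: filterS (cvgr_neq0 _ cs jl) => y; apply: contra_neq => ->.
by rewrite mxE.
Qed.

Section Leaf.
Variables (s : poisson R) (i : 'I_3) (a : C) (b1 b2 : bool).
Hypothesis s_casimir : forall y j, s true y j i = 0.
Hypothesis s_neq0 : forall x, s true (slice i a x) != 0 <-> punctured b1 b2 x.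

Lemma carrier_slice : carrier [set slice_plaque i a b1 b2] = leaf_set s i a.
Proof.
rewrite /carrier bigcup_set1; apply/seteqP; split => [_ [x /s_neq0 sx <-]|].
  by exists (slice i a x) => //; split => //; rewrite sliceE.
move=> _ [y [yi sy] <-]; exists (\row_k y 0 (lift i k)); last by rewrite /= sliceK.
by apply/s_neq0; rewrite sliceK.
Qed.

(** [lift_change] reduces the claim to the standard lift, for which [skew_slice]
    provides the matrix w. *)
Lemma slice_symplectic : symplectic s [set slice_plaque i a b1 b2].
Proof.
move=> P -> x Px c f hf.
have [M [Mu JE sE]] := lift_change (slice_lift i a b1 b2 x) hf.
have [_ sT _ _] := coefP s.
pose L := slice_mx i; pose w := L *m s true (slice i a x) *m L^T.
have sw : s true (slice i a x) = L^T *m w *m L by exact: skew_slice.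
have wT : w^T = - w by rewrite /w !trmx_mul trmxK sT mulNmx mulmxN mulmxA.
exists w; split => //.
  apply: skew2_unit => //; apply: contraTneq isT => w0.
  have /s_neq0 := Px; by rewrite sw w0 mulmx0 mul0mx eqxx.
by rewrite sE sw JE jacobian_slice trmx_mul !mulmxA.
Qed.

Hypothesis other_chart :
  forall x, s false x != 0 -> casimir_level s (leaf_set s i a) false x.

Lemma leaf_set_casimir c x : s c x != 0 -> casimir_level s (leaf_set s i a) c x.
Proof.
case: c => [sx|]; last exact: other_chart.
exists (fun y => y 0 i), a; apply: filterS (near_poisson_neq0 sx) => y sy.
split; last first.
  by split=> [[y' [yi _]] /chart_inj <- //|yi]; exists y.
have [dy py] := hp_coord y i; split => // j.
rewrite (bigD1 i) //= s_casimir mul0r add0r big1 // => l li.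
by rewrite py (negPf li) mulr0.
Qed.

(** [leaf_set_casimir] confines every connected symplectic submanifold that meets
    the level set, and the slice is such a submanifold, so it is maximal. *)
Lemma leaf_through_slice p : leaf_set s i a p ->
  leaf_through s p [set slice_plaque i a b1 b2].
Proof.
move=> sp.
have sA : connected_symplectic_submanifold s [set slice_plaque i a b1 b2].
  split; [exact: slice_plaque_immersed| |exact: slice_symplectic].
  apply: connected_plaque; last exact: punctured_connected.
  by move: sp; rewrite -carrier_slice /carrier bigcup_set1 => -[x Px _]; exists x.
have maxA k (B : set (plaque R k)) : connected_symplectic_submanifold s B ->
    carrier B p -> k = 2%N /\ carrier B `<=` leaf_set s i a.
  move=> sB Bp; have [y _ yp] := sp.
  have k2 : k = 2%N.
    rewrite -(carrier_rank (c := true) (x := y) sB) ?yp //.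
    by rewrite (carrier_rank sA) // carrier_slice yp.
  split => //; apply: (submanifold_in_casimir_level sB); last by exists p.
  move=> c x Bx; apply: leaf_set_casimir.
  by rewrite -mxrank_eq0 (carrier_rank sB Bx) k2.
split; last 2 first.
- by rewrite carrier_slice.
- move=> k B [sB mB] Bp; have [k2 BA] := maxA k B sB Bp.
  by split => //; apply/esym/mB => //; rewrite carrier_slice.
split => // k B sB; rewrite carrier_slice => AB.
have [_ BA] := maxA k B sB (AB p sp).
by apply/seteqP.
Qed.

End Leaf.
End Slice.

(** * Generic points *)

Section Generic.
Variable R : realType.
Local Notation C := (Cplx R).
Implicit Types s : poisson R.

Definition torus : set (W3 R) :=
  [set chart true x | x in [set x : 'rV[C]_3 | forall j, x 0 j != 0]].

Lemma transition_torus (x : 'rV[C]_3) :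
  (forall j, x 0 j != 0) -> forall j, transition x 0 j != 0.
Proof.
move=> x0; apply: ord3P; rewrite /transition vec3E.
- by rewrite invr_eq0.
- by rewrite mulf_neq0 ?expf_neq0.
- by rewrite mulf_neq0 ?invr_eq0.
Qed.

Lemma torusE c (x : 'rV[C]_3) : torus (chart c x) <-> forall j, x 0 j != 0.
Proof.
split=> [[y y0 /chart_eq [[_ <-] //|[_ _ ->]]]|x0]; first exact: transition_torus.
case: c; first by exists x.
exists (transition x); first exact: transition_torus.
exact: (chart_transition false (x0 0)).
Qed.

Lemma open_torus : open torus.
Proof.
suff : open (\pi_(W3 R)%qT @^-1` torus) by [].
have -> : \pi_(W3 R)%qT @^-1` torus =
    snd @^-1` [set x : 'rV[C]_3 | forall j, x 0 j != 0].
  by apply/seteqP; split => -[c x] h; apply/(torusE c x).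
apply: open_comp => [p _|]; first exact: cvg_snd.
rewrite openE => x x0; have h j := near_coord_neq0 (x0 j).
by apply: filterS3 (h 0) (h 1) (h 2) => y y0 y1 y2; apply: ord3P.
Qed.

(** Moving a point along the diagonal makes all its coordinates nonzero. *)
Lemma dense_torus : dense torus.
Proof.
move=> W [q Wq] oW; have oW' : open (\pi_(W3 R)%qT @^-1` W) by [].
have [c [x qE]] : exists c (x : 'rV[C]_3), q = chart c x.
  have := esym (reprK q); case: (repr q) => c x qE.
  by exists c, x.
have nW : nbhs (c, x) (\pi_(W3 R)%qT @^-1` W).
  by apply: open_nbhs_nbhs; split => //; by rewrite qE in Wq.
have shift_cvg : (fun t : C => x + t *: const_mx 1) @ (0 : C)^' --> x.
  rewrite -[X in _ --> X](addr0 x) -[X in _ + X](scale0r (const_mx 1)).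
  apply: cvgD; first exact: cvg_cst.
  by apply: cvgZr_tmp; apply: cvg_within_filter; exact: cvg_id.
have nWt : \forall t \near (0 : C)^', W (chart c (x + t *: const_mx 1)).
  exact: (cvg_pair (cvg_cst c) shift_cvg) nW.
have h j : \forall t \near (0 : C)^', x 0 j + t != 0.
  have [->|xj0] := eqVneq (x 0 j) 0.
    by apply: filterS (nbhs_dnbhs_neq 0) => t; rewrite add0r.
  have cj : (fun t : C => x 0 j + t : C^o) @ (0 : C)^' --> (x 0 j : C^o).
    rewrite -[X in _ --> X](addr0 (x 0 j)); apply: cvgD; first exact: cvg_cst.
    by apply: cvg_within_filter; exact: cvg_id.
  exact: cvgr_neq0 cj xj0.
(* x j + t vanishes for at most one t, so it is nonzero for small t <> 0. *)
have [t [Wt [t0 t1 t2]]] : exists t : C, W (chart c (x + t *: const_mx 1)) /\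
    [/\ x 0 0 + t != 0, x 0 1 + t != 0 & x 0 2 + t != 0].
  apply: (@filter_ex _ (0 : C)^').
  near=> t; split; first by near: t.
  by split; near: t; exact: h.
exists (chart c (x + t *: const_mx 1)); split => //; apply/torusE.
by apply: ord3P; rewrite !mxE mulr1.
Unshelve. all: by end_near. Qed.

(** The leaf of the generic point x is the level set of its i-th coordinate; the
    level is nonzero because x has no zero coordinate. *)
Lemma generic_slices s i b1 b2 (Q : set (plaque R 2) -> Prop) :
  (forall y j, s true y j i = 0) ->
  (forall a, a != 0 -> forall x,
     s true (slice i a x) != 0 <-> punctured b1 b2 x) ->
  (forall a, a != 0 -> forall x, s false x != 0 ->
     casimir_level s (leaf_set s i a) false x) ->
  (forall a, Q [set slice_plaque i a b1 b2]) ->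
  generic_leaves s Q.
Proof.
move=> s_cas s_neq0 s_V QA; exists torus.
split; [exact: open_torus|exact: dense_torus|].
move=> p [x x0 <-]; exists [set slice_plaque i (x 0 i) b1 b2]; split => //.
apply: leaf_through_slice => //.
- exact: s_neq0.
- exact: s_V.
exists x => //; split => //.
rewrite -(sliceK (i := i) (erefl (x 0 i))); apply/s_neq0 => //.
by split=> _; rewrite mxE.
Qed.

Lemma constant_slice i a b1 b2 : constant_u i [set slice_plaque i a b1 b2 : plaque R 2].
Proof.
exists a; rewrite /carrier bigcup_set1 => _ [x _ <-].
by exists (slice i a x) => //=; rewrite sliceE.
Qed.

Lemma isomorphic_slice i a b1 b2 :
  isomorphic_to (@punctured R b1 b2) [set slice_plaque i a b1 b2].
Proof.
have [iP tP] := slice_plaque_immersed i a b1 b2.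
exists (chart true \o slice i a); split.
- by move=> x y _ _ /chart_inj /slice_inj.
- by rewrite /carrier bigcup_set1.
- by move=> P ->; split; apply: tP.
Qed.

Lemma CstarxCE : @punctured R true false = CstarxC R.
Proof. by apply/seteqP; split => x; [case=> h _; exact: h|split]. Qed.

Lemma CstarxCstarE : @punctured R true true = CstarxCstar R.
Proof. by apply/seteqP; split => x [h0 h1]; split; auto. Qed.

End Generic.

(** * Coefficients and degeneracy loci *)

Section Coefficients.
Variable R : realType.
Local Notation C := (Cplx R).
Implicit Types s : poisson R.

Definition has_coefs s (a b d : bool -> 'rV[C]_3 -> C) :=
  forall c x, s c x = a c x *: wedge R 1 2 + b c x *: wedge R 2 0 + d c x *: wedge R 0 1.

Lemma coefs_eq0 s a b d c x : has_coefs s a b d ->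
  s c x = 0 <-> [/\ a c x = 0, b c x = 0 & d c x = 0].
Proof.
move=> E; split=> [s0|[a0 b0 d0]]; last by rewrite E a0 b0 d0 !scale0r !addr0.
have F := bivE (E c x).
have e12 : s c x 1 2 = a c x by rewrite F.
have e20 : s c x 2 0 = b c x by rewrite F.
have e01 : s c x 0 1 = d c x by rewrite F.
by rewrite -e12 -e20 -e01 s0 !mxE.
Qed.

Lemma degeneracyE s a b d (P Q : C -> C -> C -> Prop) : has_coefs s a b d ->
  (forall x : 'rV[C]_3, [/\ a true x = 0, b true x = 0 & d true x = 0] <->
     P (x 0 0) (x 0 1) (x 0 2)) ->
  (forall x : 'rV[C]_3, [/\ a false x = 0, b false x = 0 & d false x = 0] <->
     Q (x 0 0) (x 0 1) (x 0 2)) ->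
  degeneracy s = onU P `|` onV Q.
Proof.
move=> E EP EQ; apply/seteqP; split => p.
  move=> [c [x [-> /eqP]]]; rewrite mxrank_eq0 => /eqP /(coefs_eq0 _ _ E).
  by case: c => [/EP|/EQ] h; [left|right]; exists x.
by case=> -[x /= h <-]; [exists true|exists false]; exists x; split => //;
  apply/eqP; rewrite mxrank_eq0; apply/eqP/(coefs_eq0 _ _ E); [apply/EP|apply/EQ].
Qed.

Lemma onU_or P Q : @onU R (fun z u1 u2 => P z u1 u2 \/ Q z u1 u2) = onU P `|` onU Q.
Proof.
apply/seteqP; split => [_ [x [h|h] <-]|_ [[x h <-]|[x h <-]]].
- by left; exists x.
- by right; exists x.
- by exists x => //; left.
- by exists x => //; right.
Qed.

Lemma onV_or P Q : @onV R (fun z u1 u2 => P z u1 u2 \/ Q z u1 u2) = onV P `|` onV Q.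
Proof.
apply/seteqP; split => [_ [x [h|h] <-]|_ [[x h <-]|[x h <-]]].
- by left; exists x.
- by right; exists x.
- by exists x => //; left.
- by exists x => //; right.
Qed.

Lemma onU_false : @onU R (fun _ _ _ => False) = set0.
Proof. by apply/seteqP; split => [_ [x []] |]. Qed.

Lemma mulr_eq0E (x y : C) : (x * y = 0) = (x = 0 \/ y = 0).
Proof.
apply/propext; split=> [/eqP|[]->]; rewrite ?mul0r ?mulr0 //.
by rewrite mulf_eq0 => /orP[] /eqP; [left|right].
Qed.

Lemma oppr_eq0E (x : C) : (- x = 0) = (x = 0).
Proof. by apply/propext; split=> [/eqP|->]; rewrite ?oppr0 // oppr_eq0 => /eqP. Qed.

Lemma exprS_eq0E (x : C) n : (x ^+ n.+1 = 0) = (x = 0).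
Proof.
apply/propext; split=> [/eqP|->]; last by rewrite expr0n.
by rewrite expf_eq0 => /andP[_ /eqP].
Qed.

Lemma natrS_eq0E n : ((n.+1%:R : C) = 0) = False.
Proof. by apply/propext; split => // /eqP; rewrite pnatr_eq0. Qed.

Lemma oner_eq0E : ((1 : C) = 0) = False.
Proof. by apply/propext; split => // /eqP; rewrite oner_eq0. Qed.

Lemma eq0E : ((0 : C) = 0) = True.
Proof. exact/propext. Qed.

(** These rules turn the vanishing of a monomial into a propositional formula in
    the vanishing of the coordinates, which [tauto] decides. *)
Definition eq0_simp := (mulr_eq0E, oppr_eq0E, exprS_eq0E, natrS_eq0E, oner_eq0E, eq0E).

End Coefficients.

(** * Leaves in the level sets of z, u1 and u2 *)

Section LevelSets.
Variable R : realType.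
Local Notation C := (Cplx R).
Implicit Types s : poisson R.

Lemma slice_vec3 (a : C) (x : 'rV[C]_2) :
  [/\ slice 0 a x = vec3 a (x 0 0) (x 0 1), slice 1 a x = vec3 (x 0 0) a (x 0 1) &
     slice 2 a x = vec3 (x 0 0) (x 0 1) a].
Proof.
have L (i : 'I_3) (k : 'I_2) j : lift i k = j -> slice i a x 0 j = x 0 k.
  by move=> <-; rewrite sliceE.
by split; apply: row3P; rewrite vec3E ?sliceE //;
   by apply: L; apply: val_inj.
Qed.

Lemma puncturedE b1 b2 (x : 'rV[C]_2) :
  punctured b1 b2 x <-> (b1 ==> (x 0 0 != 0)) && (b2 ==> (x 0 1 != 0)).
Proof.
split=> [[h0 h1]|/andP[/implyP h0 /implyP h1]] //.
by apply/andP; split; apply/implyP.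
Qed.

Lemma leaf_set_chart_false s i (a : C) x :
  leaf_set s i a (chart false x) <->
  [/\ x 0 0 != 0, transition x 0 i = a & s false x != 0].
Proof.
split=> [[y [yi sy] yx]|[x0 xi sx]].
  have rk := rank_chart s yx; case/chart_eq: yx => [[]//|[_ y0 xE]].
  rewrite xE transition_neq0 // transitionK // -xE; split => //.
  by rewrite -mxrank_eq0 -rk mxrank_eq0.
have yx := chart_transition false x0; exists (transition x) => //; split => //.
by rewrite -mxrank_eq0 (rank_chart s yx) mxrank_eq0.
Qed.

Lemma casimir_level_chart_false s i (a : C) (x : 'rV[C]_3)
    (H : 'rV[C]_3 -> C) (dH : 'rV[C]_3 -> 'I_3 -> C) (h : C) :
  s false x != 0 ->
  (\forall y \near x, [/\ has_partials y H (dH y),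
     forall j, \sum_l s false y j l * dH y l = 0 &
     y 0 0 != 0 /\ transition y 0 i = a <-> H y = h]) ->
  casimir_level s (leaf_set s i a) false x.
Proof.
move=> sx hH; exists H, h.
apply: filterS2 (near_poisson_neq0 sx) hH => y sy [[dHy pH] cH <-].
split; first by split=> // j; rewrite -[RHS](cH j); apply: eq_bigr => l _; rewrite pH.
by rewrite leaf_set_chart_false; split => [[]|[]].
Qed.

(** On V the Casimir z becomes 1 / xi, with level set xi = 1 / k, and xi is
    regular everywhere. *)
Lemma generic_level_z s a b d (b1 b2 : bool) (Q : set (plaque R 2) -> Prop) :
  has_coefs s a b d ->
  (forall c x, b c x = 0 /\ d c x = 0) ->
  (forall z p q : C, z != 0 ->
     (a true (vec3 z p q) != 0) = (b1 ==> (p != 0)) && (b2 ==> (q != 0))) ->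
  (forall k, Q [set slice_plaque 0 k b1 b2]) ->
  generic_leaves s Q.
Proof.
move=> E bd aP QA; have cas c x j : s c x j 0 = 0.
  have F := bivE (E c x); have [b0 d0] := bd c x.
  by elim/(@ord3P): j; rewrite F ?b0 ?d0 ?oppr0.
apply: (generic_slices (i := 0) (b1 := b1) (b2 := b2)) => //.
  move=> k k0 x; have [-> _ _] := slice_vec3 k x; rewrite puncturedE -(aP k) //.
  split; apply: contra_neq => h; last by case/(coefs_eq0 _ _ E): h.
  by apply/(coefs_eq0 _ _ E); have [-> ->] := bd true (vec3 k (x 0 0) (x 0 1)).
move=> k k0 x sx.
apply: (casimir_level_chart_false (H := fun y => y 0 0) (dH := fun _ l => (l == 0)%:R)
  (h := k^-1)) => //.
apply: (@filterE _ _ (nbhs_filter x)) => y; split.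
- exact: hp_coord.
- by move=> j; rewrite sum3 cas /= !mulr0 mul0r !addr0.
- rewrite /transition vec3E; split => [[_ <-]|->]; first by rewrite invrK.
  by rewrite invrK invr_eq0.
Qed.

(** The function u1 = xi^3 v1 is regular on V, and where it takes a nonzero value
    one has xi <> 0, so its nonzero level sets stay inside U.  The hypothesis
    relating a and b says that it is a Casimir on V. *)
Lemma generic_level_u1 s a b d (b1 b2 : bool) (Q : set (plaque R 2) -> Prop) :
  has_coefs s a b d ->
  (forall c x, d c x = 0) -> (forall x, a true x = 0) ->
  (forall x : 'rV[C]_3, b false x * (3 * x 0 0 ^+ 2 * x 0 1) = a false x * x 0 0 ^+ 3) ->
  (forall z p q : C, z != 0 ->
     (b true (vec3 p z q) != 0) = (b1 ==> (p != 0)) && (b2 ==> (q != 0))) ->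
  (forall k, Q [set slice_plaque 1 k b1 b2]) ->
  generic_leaves s Q.
Proof.
move=> E d0 a0 ab bP QA; have F c x := bivE (E c x).
apply: (generic_slices (i := 1) (b1 := b1) (b2 := b2)) => //.
- by move=> y; elim/(@ord3P); rewrite F ?d0 ?a0 ?oppr0.
- move=> k k0 x; have [_ -> _] := slice_vec3 k x; rewrite puncturedE -(bP k) //.
  split; apply: contra_neq => h; last by case/(coefs_eq0 _ _ E): h.
  by apply/(coefs_eq0 _ _ E); rewrite a0 d0.
move=> k k0 x sx.
apply: (casimir_level_chart_false (H := fun y => y 0 0 ^+ 3 * y 0 1)
  (dH := fun y l => (3 * y 0 0 ^+ 2 * (l == 0)%:R) * y 0 1 + y 0 0 ^+ 3 * (l == 1)%:R)
  (h := k)) => //.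
apply: (@filterE _ _ (nbhs_filter x)) => y; split.
- apply: (@hp_mul _ y (fun y => y 0 0 ^+ 3)); last exact: hp_coord.
  exact: (@hp_exp _ y (fun y => y 0 0) _ 3 (hp_coord y 0)).
- move=> j; rewrite sum3 /= !mulr0 !mulr1 !mul0r !addr0 !add0r.
  elim/(@ord3P): j; rewrite !F ?d0 ?oppr0 ?mulr0 ?mul0r ?addr0 //.
  by rewrite ab mulNr subrr.
- rewrite /transition vec3E; split => [[]//|kE]; split => //.
  by apply: contra_neq k0 => y0; rewrite -kE y0 expr0n /= mul0r.
Qed.

(** On V one has u2 = v2 / xi, which is a map to the projective line away from
    xi = v2 = 0; those points are degenerate.  Near a point with xi = 0 the inverse
    xi / v2 is used, elsewhere u2 itself.  The first relation between a and d says
    that both are Casimirs on V. *)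
Lemma generic_level_u2 s a b d (b1 b2 : bool) (Q : set (plaque R 2) -> Prop) :
  has_coefs s a b d ->
  (forall c x, b c x = 0) -> (forall x, a true x = 0) ->
  (forall x : 'rV[C]_3, a false x * x 0 0 = - d false x * x 0 2) ->
  (forall x : 'rV[C]_3, x 0 0 = 0 -> x 0 2 = 0 ->
     a false x = 0 /\ d false x = 0) ->
  (forall z p q : C, z != 0 ->
     (d true (vec3 p q z) != 0) = (b1 ==> (p != 0)) && (b2 ==> (q != 0))) ->
  (forall k, Q [set slice_plaque 2 k b1 b2]) ->
  generic_leaves s Q.
Proof.
move=> E b0 a0 ad ad0 dP QA; have F c x := bivE (E c x).
apply: (generic_slices (i := 2) (b1 := b1) (b2 := b2)) => //.
- by move=> y; elim/(@ord3P); rewrite F ?b0 ?a0 ?oppr0.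
- move=> k k0 x; have [_ _ ->] := slice_vec3 k x; rewrite puncturedE -(dP k) //.
  split; apply: contra_neq => h; last by case/(coefs_eq0 _ _ E): h.
  by apply/(coefs_eq0 _ _ E); rewrite a0 b0.
move=> k k0 x sx.
(* The gradients of v2 / xi and of xi / v2 are multiples of (- v2, 0, xi). *)
have cas (y : 'rV[C]_3) (r : C) (g : 'I_3 -> C) j :
    g 0 = - y 0 2 * r -> g 1 = 0 -> g 2 = y 0 0 * r ->
    \sum_l s false y j l * g l = 0.
  move=> g0 g1 g2; rewrite sum3 g0 g1 g2 mulr0 addr0.
  elim/(@ord3P): j; rewrite !F ?b0 ?oppr0 ?mulr0 ?mul0r ?addr0 //.
  have -> : a false y * (y 0 0 * r) = (a false y * y 0 0) * r by rewrite mulrA.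
  by rewrite ad; ring.
have [x00|x0] := eqVneq (x 0 0) 0.
  have x2 : x 0 2 != 0.
    apply: contra_neq sx => x2; have [a00 d00] := ad0 x x00 x2.
    exact/(coefs_eq0 _ _ E).
  apply: (casimir_level_chart_false (H := fun y => y 0 0 * (y 0 2)^-1)
    (dH := fun y l => (l == 0)%:R * (y 0 2)^-1 + y 0 0 * (- (y 0 2) ^- 2 * (l == 2)%:R))
    (h := k^-1)) => //.
  apply: filterS (near_coord_neq0 x2) => y y2; split.
  - apply: (@hp_mul _ y (fun y => y 0 0) (fun y => (y 0 2)^-1)); first exact: hp_coord.
    by apply: hp_inv => //; exact: hp_coord.
  - move=> j; apply: (cas y (- (y 0 2) ^- 2));
      rewrite /= ?mulr0 ?mulr1 ?mul0r ?mul1r ?addr0 ?add0r //; by field.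
  - rewrite /transition vec3E; split => [[y0 <-]|kE]; first by rewrite invfM invrK.
    have y0 : y 0 0 != 0.
      by apply: contra_neq k0 => y0; rewrite -[k]invrK -kE y0 mul0r invr0.
    by split => //; rewrite -[k]invrK -kE invf_div mulrC.
apply: (casimir_level_chart_false (H := fun y => (y 0 0)^-1 * y 0 2)
  (dH := fun y l => (- (y 0 0) ^- 2 * (l == 0)%:R) * y 0 2 + (y 0 0)^-1 * (l == 2)%:R)
  (h := k)) => //.
apply: filterS (near_coord_neq0 x0) => y y0; split.
- apply: (@hp_mul _ y (fun y => (y 0 0)^-1) (fun y => y 0 2)); last exact: hp_coord.
  by apply: hp_inv => //; exact: hp_coord.
- move=> j; apply: (cas y ((y 0 0) ^- 2));
      rewrite /= ?mulr0 ?mulr1 ?mul0r ?mul1r ?addr0 ?add0r //; by field.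
- by rewrite /transition vec3E; split => [[]//|].
Qed.

End LevelSets.

(** * The ten Poisson structures *)

Ltac coefs := by case=> x; rewrite /= /on_charts /coords /=
  ?scale0r ?scale1r ?scaleNr ?addr0 ?add0r.

Ltac zeros := by move=> x; rewrite /= !eq0_simp; split=> [[]|h]; [|split]; tauto.

Section Structures.
Variable R : realType.

Lemma e1_coefs : has_coefs (e1 R)
  (fun c x => if c then x 0 1 else x 0 0 * x 0 1) (fun _ _ => 0) (fun _ _ => 0).
Proof. coefs. Qed.

Lemma e2_coefs : has_coefs (e2 R)
  (fun c x => x 0 1 * x 0 2) (fun _ _ => 0) (fun _ _ => 0).
Proof. coefs. Qed.

Lemma e3_coefs : has_coefs (e3 R)
  (fun c x => if c then 0 else - (3 * x 0 0 ^+ 2 * x 0 1))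
  (fun c x => if c then 1 else - x 0 0 ^+ 3) (fun _ _ => 0).
Proof. coefs. Qed.

Lemma e4_coefs : has_coefs (e4 R)
  (fun c x => if c then 0 else - (3 * x 0 0 * x 0 1))
  (fun c x => if c then x 0 0 else - x 0 0 ^+ 2) (fun _ _ => 0).
Proof. coefs. Qed.

Lemma e5_coefs : has_coefs (e5 R)
  (fun c x => if c then 0 else - (3 * x 0 1))
  (fun c x => if c then x 0 0 ^+ 2 else - x 0 0) (fun _ _ => 0).
Proof. coefs. Qed.

Lemma e7_coefs : has_coefs (e7 R)
  (fun c x => if c then 0 else x 0 0 * x 0 1 * x 0 2) (fun _ _ => 0)
  (fun c x => if c then x 0 1 else - (x 0 0 ^+ 2 * x 0 1)).
Proof. coefs. Qed.

Lemma e8_coefs : has_coefs (e8 R)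
  (fun c x => if c then 0 else x 0 1 * x 0 2) (fun _ _ => 0)
  (fun c x => if c then x 0 0 * x 0 1 else - (x 0 0 * x 0 1)).
Proof. coefs. Qed.

Lemma e10_coefs : has_coefs (e10 R)
  (fun c x => if c then 0 else - (3 * x 0 0 * x 0 1 * x 0 2))
  (fun c x => if c then x 0 2 else - (x 0 0 ^+ 2 * x 0 2)) (fun _ _ => 0).
Proof. coefs. Qed.

Lemma e11_coefs : has_coefs (e11 R)
  (fun c x => if c then 0 else - (3 * x 0 1 * x 0 2))
  (fun c x => if c then x 0 0 * x 0 2 else - (x 0 0 * x 0 2)) (fun _ _ => 0).
Proof. coefs. Qed.

Lemma e13_coefs : has_coefs (e13 R)
  (fun c x => if c then 0 else x 0 1 * x 0 2 ^+ 2) (fun _ _ => 0)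
  (fun c x => if c then x 0 1 * x 0 2 else - (x 0 0 * x 0 1 * x 0 2)).
Proof. coefs. Qed.

Lemma degeneracy_loci :
  degeneracy (e1 R) =
     onU (fun z u1 u2 => u1 = 0) `|` onV (fun xi v1 v2 => xi = 0)
     `|` onV (fun xi v1 v2 => v1 = 0) /\
   degeneracy (e2 R) =
     onU (fun z u1 u2 => u1 = 0) `|` onU (fun z u1 u2 => u2 = 0)
     `|` onV (fun xi v1 v2 => v1 = 0) `|` onV (fun xi v1 v2 => v2 = 0) /\
   degeneracy (e3 R) = onV (fun xi v1 v2 => xi = 0) /\
   degeneracy (e4 R) =
     onU (fun z u1 u2 => z = 0) `|` onV (fun xi v1 v2 => xi = 0) /\
   degeneracy (e5 R) =
     onU (fun z u1 u2 => z = 0)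
     `|` onV (fun xi v1 v2 => xi = 0 /\ v1 = 0) /\
   degeneracy (e10 R) =
     onU (fun z u1 u2 => u2 = 0) `|` onV (fun xi v1 v2 => xi = 0)
     `|` onV (fun xi v1 v2 => v2 = 0) /\
   degeneracy (e11 R) =
     onU (fun z u1 u2 => z = 0) `|` onU (fun z u1 u2 => u2 = 0)
     `|` onV (fun xi v1 v2 => v2 = 0)
     `|` onV (fun xi v1 v2 => xi = 0 /\ v1 = 0) /\
   degeneracy (e7 R) =
     onU (fun z u1 u2 => u1 = 0) `|` onV (fun xi v1 v2 => xi = 0)
     `|` onV (fun xi v1 v2 => v1 = 0) /\
   degeneracy (e8 R) =
     onU (fun z u1 u2 => z = 0) `|` onU (fun z u1 u2 => u1 = 0)
     `|` onV (fun xi v1 v2 => xi = 0 /\ v2 = 0)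
     `|` onV (fun xi v1 v2 => v1 = 0) /\
   degeneracy (e13 R) =
     onU (fun z u1 u2 => u1 = 0) `|` onU (fun z u1 u2 => u2 = 0)
     `|` onV (fun xi v1 v2 => v1 = 0) `|` onV (fun xi v1 v2 => v2 = 0).
Proof.
(* e3 vanishes nowhere on U. *)
have e3E : degeneracy (e3 R) = onU (fun _ _ _ => False) `|` onV (fun xi _ _ => xi = 0).
  apply: (degeneracyE e3_coefs); zeros.
rewrite e3E onU_false set0U.
(* Each locus becomes one condition on U and one condition on V. *)
rewrite -!onU_or -!(setUA, onV_or).
do !split.
- apply: (degeneracyE e1_coefs); zeros.
- apply: (degeneracyE e2_coefs); zeros.
- apply: (degeneracyE e4_coefs); zeros.
- apply: (degeneracyE e5_coefs); zeros.
- apply: (degeneracyE e10_coefs); zeros.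
- apply: (degeneracyE e11_coefs); zeros.
- apply: (degeneracyE e7_coefs); zeros.
- apply: (degeneracyE e8_coefs); zeros.
- apply: (degeneracyE e13_coefs); zeros.
Qed.

Ltac nonvanishing :=
  move=> ? ? ?; rewrite /= ?vec3E ?expf_eq0 ?mulf_eq0 ?oner_eq0;
  (move=> /negPf -> || move=> _); by rewrite ?negb_or ?orbF /= ?andbT.

Lemma generic_e1 : generic_leaves (e1 R) (isomorphic_to (CstarxC R)).
Proof.
rewrite -CstarxCE; apply: (generic_level_z (b1 := true) (b2 := false) e1_coefs) => //.
  nonvanishing.
move=> k; exact: isomorphic_slice.
Qed.

Lemma generic_e2 : generic_leaves (e2 R) (isomorphic_to (CstarxCstar R)).
Proof.
rewrite -CstarxCstarE; apply: (generic_level_z (b1 := true) (b2 := true) e2_coefs) => //.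
  nonvanishing.
move=> k; exact: isomorphic_slice.
Qed.

Ltac level_u1 b1 b2 E := apply: (generic_level_u1 (b1 := b1) (b2 := b2) E) => //;
  [by move=> x /=; ring | nonvanishing | by move=> k; exact: constant_slice].

Lemma generic_u1 s : [set e3 R; e4 R; e5 R; e10 R; e11 R] s ->
  generic_leaves s (constant_u 1 (k := 2)).
Proof.
case=> [[[[]|]|]|] ->.
- level_u1 false false e3_coefs.
- level_u1 true false e4_coefs.
- level_u1 true false e5_coefs.
- level_u1 false true e10_coefs.
- level_u1 true true e11_coefs.
Qed.

Ltac level_u2 b1 b2 E := apply: (generic_level_u2 (b1 := b1) (b2 := b2) E) => //;
  [ by move=> x /=; ring
  | by move=> ? /= -> ->; rewrite ?expr0n /= !(mulr0, mul0r) ?oppr0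
  | nonvanishing | by move=> k; exact: constant_slice].

Lemma generic_u2 s : [set e7 R; e8 R; e13 R] s ->
  generic_leaves s (constant_u 2 (k := 2)).
Proof.
case=> [[]|] ->.
- level_u2 false true e7_coefs.
- level_u2 true true e8_coefs.
- level_u2 false true e13_coefs.
Qed.

End Structures.

Theorem theorem5p10 (R : realType) :
  (* degeneracy loci *)
  (degeneracy (e1 R) =
     onU (fun z u1 u2 => u1 = 0) `|` onV (fun xi v1 v2 => xi = 0)
     `|` onV (fun xi v1 v2 => v1 = 0) /\
   degeneracy (e2 R) =
     onU (fun z u1 u2 => u1 = 0) `|` onU (fun z u1 u2 => u2 = 0)
     `|` onV (fun xi v1 v2 => v1 = 0) `|` onV (fun xi v1 v2 => v2 = 0) /\
   degeneracy (e3 R) = onV (fun xi v1 v2 => xi = 0) /\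
   degeneracy (e4 R) =
     onU (fun z u1 u2 => z = 0) `|` onV (fun xi v1 v2 => xi = 0) /\
   degeneracy (e5 R) =
     onU (fun z u1 u2 => z = 0)
     `|` onV (fun xi v1 v2 => xi = 0 /\ v1 = 0) /\
   degeneracy (e10 R) =
     onU (fun z u1 u2 => u2 = 0) `|` onV (fun xi v1 v2 => xi = 0)
     `|` onV (fun xi v1 v2 => v2 = 0) /\
   degeneracy (e11 R) =
     onU (fun z u1 u2 => z = 0) `|` onU (fun z u1 u2 => u2 = 0)
     `|` onV (fun xi v1 v2 => v2 = 0)
     `|` onV (fun xi v1 v2 => xi = 0 /\ v1 = 0) /\
   degeneracy (e7 R) =
     onU (fun z u1 u2 => u1 = 0) `|` onV (fun xi v1 v2 => xi = 0)
     `|` onV (fun xi v1 v2 => v1 = 0) /\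
   degeneracy (e8 R) =
     onU (fun z u1 u2 => z = 0) `|` onU (fun z u1 u2 => u1 = 0)
     `|` onV (fun xi v1 v2 => xi = 0 /\ v2 = 0)
     `|` onV (fun xi v1 v2 => v1 = 0) /\
   degeneracy (e13 R) =
     onU (fun z u1 u2 => u1 = 0) `|` onU (fun z u1 u2 => u2 = 0)
     `|` onV (fun xi v1 v2 => v1 = 0) `|` onV (fun xi v1 v2 => v2 = 0)) /\
  (* 0-dimensional leaves *)
  (forall s : poisson R,
     [set e1 R; e2 R; e3 R; e4 R; e5 R; e7 R; e8 R; e10 R; e11 R; e13 R] s ->
     forall p : W3 R, degeneracy s p ->
     exists A : set (plaque R 0), leaf_through s p A /\ carrier A = [set p]) /\
  (* generic leaves *)
  generic_leaves (e1 R) (isomorphic_to (CstarxC R)) /\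
  generic_leaves (e2 R) (isomorphic_to (CstarxCstar R)) /\
  (forall s : poisson R, [set e3 R; e4 R; e5 R; e10 R; e11 R] s ->
     generic_leaves s (constant_u 1 (k := 2))) /\
  (forall s : poisson R, [set e7 R; e8 R; e13 R] s ->
     generic_leaves s (constant_u 2 (k := 2))).
Proof.
split; first exact: degeneracy_loci.
split; first by move=> s _ p; exact: degenerate_leaf.
split; first exact: generic_e1.
split; first exact: generic_e2.
by split; [exact: generic_u1|exact: generic_u2].
Qed.
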